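(* Let $\mathfrak g$ be a $3$-wonderful Lie algebra, the Lie algebra of a connected affine algebraic group $G$. Let $\mathfrak X:\mathfrak g^*\to\mathfrak g^*$ be a polynomial vector field on $\mathfrak g^*$. Assume that $\mathfrak X$ annihilates all of $\Bbbk[\mathfrak g^*]^G$, i.e. $\mathfrak X\{f\}=0$ for every $f\in\Bbbk[\mathfrak g^*]^G$. Then there is a polynomial mapping $\mathfrak Y:\mathfrak g^*\to\mathfrak g$ such that $\mathfrak X(\xi)=\mathfrak Y(\xi)\cdot\xi$ for any $\xi\in\mathfrak g^*$.
   Context: The base field $\Bbbk$ is algebraically closed of characteristic $0$. $G$ is a connected affine algebraic group with Lie algebra $\mathfrak g$; it acts on $\mathfrak g^*$ by the coadjoint representation, and $x\cdot\xi$ ($x\in\mathfrak g$, $\xi\in\mathfrak g^*$) denotes the coadjoint action of $\mathfrak g$. $\Bbbk[\mathfrak g^*]^G$ is the algebra of $G$-invariant polynomial functions. The set $\mathfrak g^*_{reg}$ is the union of the $G$-orbits of maximal dimension in $\mathfrak g^*$. The index $\mathrm{ind}\,\mathfrak g$ is the minimal dimension of the stabilisers $\mathfrak g_\xi=\{x\in\mathfrak g\mid x\cdot\xi=0\}$, $\xi\in\mathfrak g^*$. $\mathfrak g$ is called $3$-wonderful if: (i) $\mathrm{codim}(\mathfrak g^*\setminus\mathfrak g^*_{reg})\ge 3$ (the empty set has codimension $\infty$); (ii) $\Bbbk[\mathfrak g^*]^G$ is a polynomial algebra of Krull dimension $\mathrm{ind}\,\mathfrak g$; (iii) the sum of the degrees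 of free homogeneous generators of $\Bbbk[\mathfrak g^*]^G$ equals $(\dim\mathfrak g+\mathrm{ind}\,\mathfrak g)/2$. A polynomial vector field $\mathfrak X:\mathfrak g^*\to\mathfrak g^*$ acts on $f\in\Bbbk[\mathfrak g^*]$ by $\mathfrak X\{f\}(\xi)=\langle\mathfrak X(\xi),(df)_\xi\rangle$, where $(df)_\xi\in\mathfrak g$ is the differential of $f$ at $\xi$. *)

(* Defs.v *)
From mathcomp Require Export all_boot all_order all_algebra.
From mathcomp Require Export mpoly.

Set Implicit Arguments.
Unset Strict Implicit.
Unset Printing Implicit Defensive.

Import GRing.Theory.
Local Open Scope ring_scope.

(* Points of affine n-space are row vectors x : 'rV[k]_n; the value at x of a
   polynomial f is f.@[x 0]. *)

Section PolynomialMaps.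
Variable k : fieldType.

Definition polymap (n p : nat) := p.-tuple {mpoly k[n]}.

Definition pm_eval n p (A : polymap n p) (x : 'rV[k]_n) : 'rV[k]_p :=
  \row_i (tnth A i).@[x 0].

Definition pm_id n : polymap n n := [tuple 'X_i | i < n].

Definition pm_const n p (a : 'rV[k]_p) : polymap n p :=
  [tuple (a 0 i)%:MP | i < p].

Definition pm_pair n p q (A : polymap n p) (B : polymap n q) :
  polymap n (p + q) := [tuple of A ++ B].

Definition pm_comp n p q (B : polymap p q) (A : polymap n p) : polymap n q :=
  [tuple (tnth B i) \mPo A | i < q].

(* <v, d_a f> *)
Definition dpoly n (f : {mpoly k[n]}) (a v : 'rV[k]_n) : k :=
  \sum_i f^`M(i).@[a 0] * v 0 i.

Definition pm_diff n p (A : polymap n p) (a v : 'rV[k]_n) : 'rV[k]_p :=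
  \row_i dpoly (tnth A i) a v.

End PolynomialMaps.

Section ZariskiTopology.
Variables (k : fieldType) (n : nat).
Implicit Types S Z : 'rV[k]_n -> Prop.

Definition vanishes_on S (f : {mpoly k[n]}) : Prop :=
  forall x, S x -> f.@[x 0] = 0.

Definition zclosed Z : Prop :=
  exists I : {mpoly k[n]} -> Prop,
    forall x, Z x <-> (forall f, I f -> f.@[x 0] = 0).

(* connected for the topology induced on S *)
Definition zconnected S : Prop :=
  forall Z1 Z2, zclosed Z1 -> zclosed Z2 ->
    (forall x, S x -> Z1 x \/ Z2 x) ->
    (forall x, S x -> ~ (Z1 x /\ Z2 x)) ->
    (forall x, S x -> Z1 x) \/ (forall x, S x -> Z2 x).

(* The dimension of a locally closed set S (or of its closure) is the
   transcendence degree of its polynomial functions: the largest d such that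
   some d polynomials satisfy no nontrivial polynomial relation on S. For
   reducible S this is the maximum over the components; the empty set has no
   dimension. *)
Definition dim_ge S (d : nat) : Prop :=
  exists f : d.-tuple {mpoly k[n]},
    forall P : {mpoly k[d]}, vanishes_on S (P \mPo f) -> P = 0.

Definition has_dim S (d : nat) : Prop := dim_ge S d /\ ~ dim_ge S d.+1.

(* codimension in the affine n-space; the empty set has infinite codimension *)
Definition codim_ge Z (c : nat) : Prop := forall d, has_dim Z d -> (d + c <= n)%N.

End ZariskiTopology.

(* Here A is (the underlying set of) a subring of R. *)
Section KrullDimension.
Variables (R : comNzRingType) (A : R -> Prop).

Definition prime_ideal_of (P : R -> Prop) : Prop :=
  [/\ (forall a, P a -> A a),
      [/\ P 0, (forall a b, P a -> P b -> P (a + b))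
             & (forall a b, A a -> P b -> P (a * b))],
      ~ P 1
    & forall a b, A a -> A b -> P (a * b) -> P a \/ P b].

Definition prime_chain (d : nat) : Prop :=
  exists P : nat -> R -> Prop,
    (forall i, (i <= d)%N -> prime_ideal_of (P i)) /\
    (forall i, (i < d)%N -> (forall a, P i a -> P i.+1 a) /\
                        (exists a, P i.+1 a /\ ~ P i a)).

Definition has_krull_dim (d : nat) : Prop :=
  prime_chain d /\ ~ prime_chain d.+1.

End KrullDimension.

Section FreeGenerators.
Variables (k : fieldType) (n : nat).

(* f_1, ..., f_r are algebraically independent and generate the algebra A *)
Definition free_generators (A : {mpoly k[n]} -> Prop) (r : nat)
    (f : r.-tuple {mpoly k[n]}) : Prop :=
  (forall P : {mpoly k[r]}, P \mPo f = 0 -> P = 0) /\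
  (forall a, A a <-> exists P : {mpoly k[r]}, a = P \mPo f).

End FreeGenerators.

(* An affine algebraic group: a Zariski closed subset of an affine space with
   polynomial multiplication and inversion. The group axioms are only required
   on the closed set, not on the ambient space. *)
Record affAlgGroup (k : fieldType) := AffAlgGroup {
  ag_amb : nat;
  ag_mem : 'rV[k]_ag_amb -> Prop;
  ag_mul : polymap k (ag_amb + ag_amb) ag_amb;
  ag_inv : polymap k ag_amb ag_amb;
  ag_one : 'rV[k]_ag_amb;
  ag_closed : zclosed ag_mem;
  ag_mem1 : ag_mem ag_one;
  ag_memM : forall g h, ag_mem g -> ag_mem h ->
    ag_mem (pm_eval ag_mul (row_mx g h));
  ag_memV : forall g, ag_mem g -> ag_mem (pm_eval ag_inv g);
  ag_mulA : forall g h l, ag_mem g -> ag_mem h -> ag_mem l ->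
    pm_eval ag_mul (row_mx g (pm_eval ag_mul (row_mx h l))) =
    pm_eval ag_mul (row_mx (pm_eval ag_mul (row_mx g h)) l);
  ag_mul1 : forall g, ag_mem g -> pm_eval ag_mul (row_mx ag_one g) = g;
  ag_mulV : forall g, ag_mem g ->
    pm_eval ag_mul (row_mx (pm_eval ag_inv g) g) = ag_one
}.

Section LieAlgebra.
Variables (k : fieldType) (G : affAlgGroup k).
Local Notation m := (ag_amb G).
Local Notation e := (ag_one G).

(* the tangent space T_e G, the underlying space of the Lie algebra *)
Definition tangent1 (v : 'rV[k]_m) : Prop :=
  forall f, vanishes_on (@ag_mem _ G) f -> dpoly f e v = 0.

(* The left-invariant vector field g |-> d_e(h |-> g h)(v); by the chain rule
   its i-th coordinate is \sum_j v_j * (d mul_i / d h_j)(g, e). *)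
Definition linv_field (v : 'rV[k]_m) : polymap k m m :=
  [tuple \sum_(j < m) v 0 j *:
      ((tnth (ag_mul G) i)^`M(rshift m j) \mPo pm_pair (pm_id k m) (pm_const m e))
    | i < m].

(* The value at e of the commutator of the left-invariant vector fields that
   take the values v and w at e. *)
Definition lie_bracket (v w : 'rV[k]_m) : 'rV[k]_m :=
  pm_diff (linv_field w) e v - pm_diff (linv_field v) e w.

(* h |-> (g h) g^-1 *)
Definition conj_map (g : 'rV[k]_m) : polymap k m m :=
  let gh := pm_comp (ag_mul G) (pm_pair (pm_const m g) (pm_id k m)) in
  pm_comp (ag_mul G) (pm_pair gh (pm_const m (pm_eval (ag_inv G) g))).

Definition Adjoint (g v : 'rV[k]_m) : 'rV[k]_m := pm_diff (conj_map g) e v.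

(* The rows of b form a basis of the Lie algebra of G. *)
Definition lie_basis (n : nat) (b : 'M[k]_(n, m)) : Prop :=
  row_free b /\ forall v : 'rV[k]_m, (v <= b)%MS <-> tangent1 v.

End LieAlgebra.

(* From now on a basis b of the Lie algebra g of G is fixed. An element of g is
   given by its coordinates x : 'rV_n in this basis, an element of g^* by its
   coordinates xi : 'rV_n in the dual basis, and {mpoly k[n]} is the algebra of
   polynomial functions on g^*. *)
Section Coadjoint.
Variables (k : fieldType) (G : affAlgGroup k) (n : nat).
Variable b : 'M[k]_(n, ag_amb G).
Implicit Types (x y xi : 'rV[k]_n) (g : 'rV[k]_(ag_amb G)).
Implicit Types (f : {mpoly k[n]}) (X : polymap k n n).

Definition pairing xi x : k := \sum_j xi 0 j * x 0 j.

Definition coords (v : 'rV[k]_(ag_amb G)) : 'rV[k]_n := v *m pinvmx b.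

Definition br x y : 'rV[k]_n := coords (lie_bracket (x *m b) (y *m b)).

Definition Ad g x : 'rV[k]_n := coords (Adjoint g (x *m b)).

(* <g.xi, y> = <xi, Ad(g^-1) y> *)
Definition coAd g xi : 'rV[k]_n :=
  \row_j pairing xi (Ad (pm_eval (ag_inv G) g) (delta_mx 0 j)).

(* <x.xi, y> = - <xi, [x, y]> *)
Definition coad x xi : 'rV[k]_n := \row_j - pairing xi (br x (delta_mx 0 j)).

Definition stab_dim xi : nat := \rank (kermx (lin1_mx (coad^~ xi))).

Definition is_index (l : nat) : Prop :=
  (exists xi, stab_dim xi = l) /\ (forall xi, (l <= stab_dim xi)%N).

Definition orbit_of xi : 'rV[k]_n -> Prop :=
  fun eta => exists2 g, ag_mem g & eta = coAd g xi.

Definition regular xi : Prop :=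
  exists2 d, has_dim (orbit_of xi) d
           & forall eta d', has_dim (orbit_of eta) d' -> (d' <= d)%N.

Definition invariant f : Prop :=
  forall g xi, ag_mem g -> f.@[coAd g xi 0] = f.@[xi 0].

Definition wonderful3 : Prop :=
  exists2 l, is_index l &
  [/\ codim_ge (fun xi => ~ regular xi) 3,
      (exists r (F : r.-tuple {mpoly k[n]}), free_generators invariant F) /\
      has_krull_dim invariant l
    & exists r (F : r.-tuple {mpoly k[n]}) (deg : 'I_r -> nat),
        [/\ free_generators invariant F,
            forall i, tnth F i \is (deg i).-homog
          & (2 * \sum_(i < r) deg i = n + l)%N]].

Definition grad f xi : 'rV[k]_n := \row_j f^`M(j).@[xi 0].

(* X{f}(xi) *)
Definition act_on X f xi : k := pairing (pm_eval X xi) (grad f xi).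

End Coadjoint.

(* Main.v *)
(** For a vector field X killing all invariants one has to solve X = P Y, where
P is the matrix of linear forms with P(xi) y = y.xi. Let D be the matrix of the
differentials of the free generators f_1, ..., f_l. It has rank l (Jacobian
criterion) and D^T P = 0. For constant n x l matrices A and B the bordered minor
M_AB = det [[P, A], [B^T, 0]] is proportional to q_A q_B, where q_A = det(D^T A);
the factor is independent of A and B, it is a polynomial because the M_AB
contain a regular sequence of length 2, and by the degree assumption it is a
constant. Hence the complex 0 -> S^l -> S^n -> S^n -> S^l with maps D, P, D^T
becomes exact after inverting any M_AB; the ideal they generate contains a
regular sequence h_1, h_2, h_3, and a Koszul argument on the solutions of
h_i X = P Y_i gives X = P Y.

The regular sequence exists because the common zeros of the M_AB are not
regular: an orbit G xi has dimension rank P(xi). The lower bound is read off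
from iterated left-invariant derivatives at the identity; for the upper bound
the derivations d/df_i are extended to a generic point of G and translated to
the identity. *)

From HB Require Import structures.
From mathcomp Require boolp classical_sets.
From mathcomp Require Import zify ring.
Require Import Defs.

Set Implicit Arguments.
Unset Strict Implicit.
Unset Printing Implicit Defensive.
Import GRing.Theory.
Local Open Scope ring_scope.

(** * Extension of derivations in characteristic 0 *)

(** The number (n + l)/2 balances degrees: M_AB is homogeneous of degree n - l and q_A q_B of degree
    2 (sum of the degrees of the f_i) - 2l, so the degree assumption says exactly that their
    quotient has degree 0. Codimension 3 matches the length of the complex. Two regular elements
    suffice to recover the kernel of P from its localisations, but the local solutions Y_i differ by
    kernel elements, and the resulting obstruction modulo (h_1, h_2) is killed only with the help of
    h_3. The assumptions give the Krull dimension l of the invariants, not the number r of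
    generators. A chain of primes of length l yields l independent invariants, so l <= r; conversely
    D^T P = 0 bounds r by the corank of P at a generic point. Dimension means transcendence degree
    on sets that may be reducible. A generic point is therefore a homomorphism to the residue field
    of a prime ideal avoiding the nonzero polynomials in the chosen independent functions. Regular
    sequences come from Noether normalisation: each new element is monic in a variable that the
    previous ones do not involve. *)

Lemma nat_least (Q : nat -> Prop) :
  (exists n, Q n) -> exists n, Q n /\ forall m, Q m -> (n <= m)%N.
Proof.
move=> [n0 Qn0]; have ex : exists n, boolp.asbool (Q n) by exists n0; apply/boolp.asboolP.
case: (ex_minnP ex) => n /boolp.asboolP Qn nmin; exists n; split=> // m Qm.
by apply: nmin; apply/boolp.asboolP.
Qed.

Lemma natr_neq0 (L : idomainType) : [pchar L] =i pred0 ->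
  forall n : nat, (n.+1%:R : L) != 0.
Proof. by move=> char0 n; rewrite ((pcharf0P L).1 char0). Qed.

Lemma mpoly_gen_ind (R : comNzRingType) n (P : {mpoly R[n]} -> Prop) :
  (forall c, P c%:MP) -> (forall i, P 'X_i) ->
  (forall p q, P p -> P q -> P (p + q)) ->
  (forall p q, P p -> P q -> P (p * q)) -> forall p, P p.
Proof.
move=> hC hX hD hM p; elim/mpolyind: p => [|c m p _ _ hp]; first by rewrite -mpolyC0.
apply: (hD) => //; rewrite -mul_mpolyC; apply: (hM) => //.
rewrite mpolyXE_id; apply: (big_ind P) => [||i _]; [by rewrite -mpolyC1|exact: hM|].
elim: (m i) => [|e IHe]; first by rewrite expr0 -mpolyC1.
by rewrite exprS; apply: hM.
Qed.

Section DerivationExtension.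
Variable L : fieldType.
Hypothesis char0 : [pchar L] =i pred0.

(** [K] is a predicate and [D] a total function with laws imposed on [K] only, so that the domain
    can grow inside the fixed field [L], one element at a time. *)
Record derivation_on (K : L -> Prop) (D : L -> L) := DerivationOn {
  der_one : K 1;
  der_subK : forall a b, K a -> K b -> K (a - b);
  der_mulK : forall a b, K a -> K b -> K (a * b);
  der_sub : forall a b, K a -> K b -> D (a - b) = D a - D b;
  der_mul : forall a b, K a -> K b -> D (a * b) = a * D b + D a * b
}.

Section Step.
Variables (K : L -> Prop) (D : L -> L) (KD : derivation_on K D).

Lemma der_zeroK : K 0.
Proof. by rewrite -(subrr 1); apply: (der_subK KD); apply: (der_one KD). Qed.

Lemma der_zero : D 0 = 0.
Proof. by rewrite -(subrr 0) (der_sub KD) ?subrr //; apply: der_zeroK. Qed.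

Lemma der_oppK a : K a -> K (- a).
Proof. by rewrite -sub0r; apply: (der_subK KD); apply: der_zeroK. Qed.

Lemma der_addK a b : K a -> K b -> K (a + b).
Proof. by move=> Ka Kb; rewrite -(opprK b); apply: (der_subK KD) => //; apply: der_oppK. Qed.

Lemma der_add a b : K a -> K b -> D (a + b) = D a + D b.
Proof.
move=> Ka Kb; rewrite -{1}(opprK b) (der_sub KD) //; last exact: der_oppK.
by rewrite -(sub0r b) (der_sub KD) ?der_zero ?sub0r ?opprK //; apply: der_zeroK.
Qed.

Lemma der_sumK I (r : seq I) (F : I -> L) : (forall i, K (F i)) -> K (\sum_(i <- r) F i).
Proof. by move=> KF; apply: (big_ind K) => //; [apply: der_zeroK|apply: der_addK]. Qed.

Lemma der_sum I (r : seq I) (F : I -> L) :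
  (forall i, K (F i)) -> D (\sum_(i <- r) F i) = \sum_(i <- r) D (F i).
Proof.
move=> KF; elim: r => [|i r IHr]; first by rewrite !big_nil der_zero.
by rewrite !big_cons der_add ?IHr //; apply: der_sumK.
Qed.

Definition polyin (p : {poly L}) := forall i, K p`_i.

Lemma polyinC a : K a -> polyin a%:P.
Proof. by move=> Ka i; rewrite coefC; case: eqP => // _; apply: der_zeroK. Qed.

Lemma polyinX : polyin 'X.
Proof. by move=> i; rewrite coefX; case: eqP => _; [apply: (der_one KD)|apply: der_zeroK]. Qed.

Lemma polyinB p q : polyin p -> polyin q -> polyin (p - q).
Proof. by move=> Kp Kq i; rewrite coefB; apply: (der_subK KD). Qed.

Lemma polyinD p q : polyin p -> polyin q -> polyin (p + q).
Proof. by move=> Kp Kq i; rewrite coefD; apply: der_addK. Qed.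

Lemma polyinM p q : polyin p -> polyin q -> polyin (p * q).
Proof. by move=> Kp Kq i; rewrite coefM; apply: der_sumK => j; apply: (der_mulK KD). Qed.

Lemma polyin_deriv p : polyin p -> polyin p^`().
Proof.
move=> Kp i; rewrite coef_deriv; move: (p`_i.+1) (Kp i.+1) => c Kc.
elim: (i.+1) => [|e IHe]; first exact: der_zeroK.
by rewrite mulrS; apply: der_addK.
Qed.

Lemma polyin_lead p : polyin p -> K (lead_coef p).
Proof. by move=> Kp; apply: Kp. Qed.

Lemma polyinXn e : polyin 'X^e.
Proof.
elim: e => [|e IHe]; first by rewrite expr0 -polyC1; apply: polyinC; apply: (der_one KD).
by rewrite exprS; apply: polyinM => //; apply: polyinX.
Qed.

Lemma polyin_exp p e : polyin p -> polyin (p ^+ e).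
Proof.
move=> Kp; elim: e => [|e IHe]; first by rewrite expr0 -polyC1; apply: polyinC; apply: (der_one KD).
by rewrite exprS; apply: polyinM.
Qed.

(** The power of the leading coefficient is there because [K] is only a subring: quotient and
    remainder must keep their coefficients in [K], where the leading coefficient need not be
    invertible. *)
Lemma polyin_pseudo_div P : polyin P -> P != 0 -> forall h, polyin h ->
  exists N q r, [/\ polyin q, polyin r, (size r < size P)%N
                  & (lead_coef P)%:P ^+ N * h = q * P + r].
Proof.
move=> KP P0 h; have [n] := ubnP (size h); elim: n h => // n IHn h hn Kh.
have [hP|hP] := ltnP (size h) (size P).
  exists 0%N, 0, h; split=> //; first by apply: (@polyinC 0); apply: der_zeroK.
  by rewrite expr0 mul1r mul0r add0r.
pose s := (lead_coef h)%:P * 'X^(size h - size P).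
have Ks : polyin s by apply: polyinM; [apply/polyinC/polyin_lead|apply: polyinXn].
pose h' := (lead_coef P)%:P * h - s * P.
have Kh' : polyin h'.
  by apply: polyinB; apply: polyinM => //; apply/polyinC/polyin_lead.
have sP : (0 < size P)%N by rewrite size_poly_gt0.
have h'n : (size h' < n)%N.
  apply: leq_trans (_ : size h <= n)%N => //; rewrite -(prednK (leq_trans sP hP)) ltnS.
  apply/leq_sizeP => j; rewrite leq_eqVlt => /orP[/eqP<-|hj].
    rewrite /h' /s coefB coefCM -mulrA coefCM coefXnM.
    have -> : ((size h).-1 < size h - size P)%N = false by apply/negbTE; rewrite -leqNgt; lia.
    have -> : ((size h).-1 - (size h - size P) = (size P).-1)%N by lia.
    by rewrite !lead_coefE mulrC subrr.
  rewrite /h' /s coefB coefCM -mulrA coefCM coefXnM.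
  rewrite [h`_j]nth_default ?mulr0; last by rewrite -(prednK (leq_trans sP hP)).
  case: ltnP => hj'; first by rewrite mulr0 subr0.
  have aux a b : (0 < b -> b <= a -> a.-1 < j -> b <= j - (a - b))%N by lia.
  by rewrite [P`_ _]nth_default ?mulr0 ?subr0 //; apply: aux.
have [N [q [r [Kq Kr rP e]]]] := IHn _ h'n Kh'.
exists N.+1, (q + (lead_coef P)%:P ^+ N * s), r; split=> //.
  by apply: polyinD => //; apply: polyinM => //; apply/polyin_exp/polyinC/polyin_lead.
rewrite exprSr -mulrA (_ : _ * h = h' + s * P); last by rewrite /h' subrK.
by rewrite mulrDr e mulrDl mulrA addrAC.
Qed.

Lemma map_der_sub p q : polyin p -> polyin q ->
  map_poly D (p - q) = map_poly D p - map_poly D q.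
Proof.
move=> Kp Kq; apply/polyP => i.
by rewrite coefB !coef_map_id0 ?der_zero // coefB (der_sub KD).
Qed.

Lemma map_der_mul p q : polyin p -> polyin q ->
  map_poly D (p * q) = p * map_poly D q + map_poly D p * q.
Proof.
move=> Kp Kq; apply/polyP => i.
rewrite coefD coef_map_id0 ?der_zero // !coefM der_sum; last first.
  by move=> j; apply: (der_mulK KD).
rewrite -big_split; apply: eq_bigr => j _ /=.
by rewrite !coef_map_id0 ?der_zero // (der_mul KD).
Qed.

Variables (x w : L).

(** The value at p(x) forced on any extension of [D] that sends x to w. *)
Definition ext_value (p : {poly L}) := (map_poly D p).[x] + p^`().[x] * w.

Lemma ext_value_sub p q : polyin p -> polyin q ->
  ext_value (p - q) = ext_value p - ext_value q.
Proof. by move=> Kp Kq; rewrite /ext_value map_der_sub // derivB !hornerE; ring. Qed.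

Lemma ext_value_mul p q : polyin p -> polyin q ->
  ext_value (p * q) = p.[x] * ext_value q + ext_value p * q.[x].
Proof. by move=> Kp Kq; rewrite /ext_value map_der_mul // derivM !hornerE; ring. Qed.

Lemma ext_valueC a : K a -> ext_value a%:P = D a.
Proof.
move=> Ka; rewrite /ext_value derivC horner0 mul0r addr0.
have -> : map_poly D a%:P = (D a)%:P.
  apply/polyP => i; rewrite coef_map_id0 ?der_zero // !coefC.
  by case: eqP => // _; rewrite der_zero.
by rewrite hornerC.
Qed.

End Step.

(** If x satisfies no relation over [K], any w will do. Otherwise take a relation P of least degree:
    P'(x) != 0 by minimality and characteristic 0, and applying the derivation to P(x) = 0 forces w.
    Any other relation is a multiple of P up to a power of the leading coefficient, so the extension
    is well defined on K[x]. *)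
Lemma derivation_adjoin K D (x : L) : derivation_on K D ->
  exists K' D', [/\ derivation_on K' D', (forall y, K y -> K' y), K' x
                  & forall y, K y -> D' y = D y].
Proof.
move=> KD.
have [w hw] : exists w, forall p, polyin K p -> p.[x] = 0 -> ext_value D x w p = 0.
  have [[P0 hP0]|noP] := boolp.EM (exists P, [/\ polyin K P, P != 0 & P.[x] = 0]); last first.
    exists 0 => p Kp px; have -> : p = 0.
      by apply/eqP/negPn/negP => p0; apply: noP; exists p.
    by rewrite -polyC0 (ext_valueC KD) ?(der_zero KD) //; apply: (der_zeroK KD).
  have [|n [[P [[KP P_neq0 Px] sP]] nmin]] := @nat_least
    (fun n => exists P, [/\ polyin K P, P != 0 & P.[x] = 0] /\ size P = n).
    by exists (size P0), P0.
  have minP q : polyin K q -> (size q < size P)%N -> q.[x] = 0 -> q = 0.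
    move=> Kq qP qx; apply/eqP/negPn/negP => q0.
    have : (size P <= size q)%N by rewrite sP; apply: nmin; exists q.
    by rewrite leqNgt qP.
  have sP1 : (1 < size P)%N.
    rewrite ltnNge; apply/negP => /size1_polyC e; move: P_neq0 Px.
    by rewrite e hornerC polyC_eq0 => /eqP.
  have dP0 : P^`() != 0.
    apply/eqP => /(congr1 (fun q : {poly L} => q`_(size P).-2)).
    rewrite coef_deriv coef0 -mulr_natr prednK; last by rewrite -ltnS (ltn_predK sP1).
    move/eqP; rewrite mulf_eq0 => /orP[]; first by rewrite lead_coef_eq0 (negbTE P_neq0).
    by rewrite -(prednK (_ : 0 < (size P).-1)%N) ?(negbTE (natr_neq0 char0 _)) // -ltnS (ltn_predK sP1).
  have dPx : P^`().[x] != 0.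
    apply/negP => /eqP dPx; case/eqP: dP0; apply: minP => //.
      exact: (polyin_deriv KD).
    exact: lt_size_deriv.
  exists (- (map_poly D P).[x] / P^`().[x]) => p Kp px.
  set w := _ / _.
  have vP : ext_value D x w P = 0 by rewrite /ext_value /w mulrC divfK // subrr.
  have [N [q [r [Kq Kr rP e]]]] := polyin_pseudo_div KD KP P_neq0 Kp.
  set c := _ ^+ N in e.
  have Kc : polyin K c by apply: (polyin_exp KD); apply: (polyinC KD); apply: polyin_lead.
  have r0 : r = 0.
    apply: minP => //; have := congr1 (fun q : {poly L} => q.[x]) e.
    by rewrite !hornerE px Px !mulr0 add0r => <-.
  (* Since p, P and [ext_value] of P all vanish at x, only the nonzero constant times [ext_value] of
     p survives. *)
  have := congr1 (ext_value D x w) e.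
  rewrite r0 addr0 !(ext_value_mul KD) // px Px vP !mulr0 !addr0 => /eqP.
  rewrite mulf_eq0 /c -rmorphXn hornerC expf_eq0 lead_coef_eq0 (negbTE P_neq0) andbF.
  by move/eqP.
pose K' y := exists2 p, polyin K p & y = p.[x].
have [D' hD'] : exists D' : L -> L, forall p, polyin K p -> D' p.[x] = ext_value D x w p.
  have /boolp.choice [D' hD'] (y : L) : exists z : L,
      forall p, polyin K p -> p.[x] = y -> ext_value D x w p = z.
    have [[p Kp ey]|no] := boolp.EM (K' y).
      exists (ext_value D x w p) => q Kq qy; apply/eqP.
      rewrite -subr_eq0 -(ext_value_sub KD) // hw //; first exact: (polyinB KD).
      by rewrite !hornerE qy ey subrr.
    by exists 0 => p Kp py; case: no; exists p.
  by exists D' => p Kp; rewrite -(hD' _ p).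
exists K', D'; split=> [|y Ky||y Ky].
- split=> [|_ _ [p Kp ->] [q Kq ->]|_ _ [p Kp ->] [q Kq ->]|_ _ [p Kp ->] [q Kq ->]|_ _ [p Kp ->] [q Kq ->]].
  + by exists 1; rewrite ?hornerE //; apply: (polyinC KD); apply: der_one KD.
  + by exists (p - q); rewrite ?hornerE //; apply: (polyinB KD).
  + by exists (p * q); rewrite ?hornerE //; apply: (polyinM KD).
  + rewrite (hD' p) // (hD' q) // -(ext_value_sub KD) // -hD' ?hornerE //.
    exact: (polyinB KD).
  + rewrite (hD' p) // (hD' q) // -(ext_value_mul KD) // -hD' ?hornerE //.
    exact: (polyinM KD).
- by exists y%:P; rewrite ?hornerC //; apply: (polyinC KD).
- by exists 'X; rewrite ?hornerX //; apply: (polyinX KD).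
- by rewrite -(hornerC y x) hD' ?(ext_valueC KD) ?hornerC //; apply: (polyinC KD).
Qed.

Lemma derivation_adjoin_seq (s : seq L) K D : derivation_on K D ->
  exists K' D', [/\ derivation_on K' D', (forall y, K y -> K' y),
    (forall x, x \in s -> K' x) & forall y, K y -> D' y = D y].
Proof.
elim: s K D => [|x s IHs] K D KD; first by exists K, D.
have [K1 [D1 [KD1 K01 K1x D10]]] := derivation_adjoin x KD.
have [K2 [D2 [KD2 K12 K2s D21]]] := IHs _ _ KD1.
exists K2, D2; split=> // [y /K01/K12//|z|y Ky].
  by rewrite inE => /orP[/eqP->|/K2s//]; apply: K12.
by rewrite D21 ?D10 //; apply: K01.
Qed.

End DerivationExtension.

Lemma mderivXU (R : nzRingType) n (i j : 'I_n) : ('X_i : {mpoly R[n]})^`M(j) = (i == j)%:R.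
Proof.
rewrite mderivX mnm1E; have [->|_] := eqVneq; last by rewrite scale0r.
by rewrite -{1}(add0m U_(j)%MM) addmK scale1r mpolyX0.
Qed.

Section DerivationLift.
Variables (k L : fieldType) (m d : nat) (ev : {rmorphism {mpoly k[m]} -> L}).

Lemma pchar_rmorph_mpoly : [pchar k] =i pred0 -> [pchar L] =i pred0.
Proof. by move=> char0 p; rewrite (fmorph_pchar (ev \o @mpolyC m k)) char0. Qed.

Variable f : d.-tuple {mpoly k[m]}.
Hypothesis indep : forall P : {mpoly k[d]}, ev (P \mPo f) = 0 -> P = 0.

(** Independence makes P unique for a given value ev (P o f), so d/df_q is well defined on the
    subring generated by f. *)
Lemma derivation_on_free (q : 'I_d) : exists D,
  derivation_on (fun y => exists P, y = ev (P \mPo f)) D /\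
  forall P, D (ev (P \mPo f)) = ev (P^`M(q) \mPo f).
Proof.
have [D hD] : exists D, forall P, D (ev (P \mPo f)) = ev (P^`M(q) \mPo f).
  have /boolp.choice [D hD] (y : L) : exists z, forall P,
      ev (P \mPo f) = y -> ev (P^`M(q) \mPo f) = z.
    have [[P0 e]|no] := boolp.EM (exists P, y = ev (P \mPo f)); last first.
      by exists 0 => P e; case: no; exists P.
    exists (ev (P0^`M(q) \mPo f)) => P eP; congr (ev (_^`M(q) \mPo f)).
    apply/eqP; rewrite -subr_eq0; apply/eqP/indep.
    by rewrite comp_mpolyB rmorphB eP e subrr.
  by exists D => P; rewrite -(hD _ P).
exists D; split=> //; split=> [|_ _ [P ->] [Q ->]|_ _ [P ->] [Q ->]|_ _ [P ->] [Q ->]|_ _ [P ->] [Q ->]].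
- by exists 1; rewrite comp_mpoly1 rmorph1.
- by exists (P - Q); rewrite comp_mpolyB rmorphB.
- by exists (P * Q); rewrite !rmorphM.
- by rewrite -rmorphB -comp_mpolyB !hD mderivB comp_mpolyB rmorphB.
- by rewrite -!rmorphM !hD mderivM !rmorphD !rmorphM /= addrC.
Qed.

(** Row q lists the values on the coordinates of an extension of d/df_q. It is a tangent vector at
    the generic point [ev]: it annihilates the relations and is dual to the differentials of f. *)
Lemma derivation_lift : [pchar k] =i pred0 ->
  exists W : 'M[L]_(d, m), forall q,
    (forall h, ev h = 0 -> \sum_j ev h^`M(j) * W q j = 0) /\
    (forall i, \sum_j ev (tnth f i)^`M(j) * W q j = (i == q)%:R).
Proof.
move=> /pchar_rmorph_mpoly char0.
suff hw q : exists w : 'I_m -> L, (forall h, ev h = 0 -> \sum_j ev h^`M(j) * w j = 0) /\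
    (forall i, \sum_j ev (tnth f i)^`M(j) * w j = (i == q)%:R).
  have [w hw'] := boolp.choice hw; exists (\matrix_(q, j) w q j) => q.
  by split=> [h /((hw' q).1)|i]; [|rewrite -(hw' q).2]; move=> *;
    under eq_bigr => j _ do rewrite mxE.
have [D0 [KD0 hD0]] := derivation_on_free q.
have [K [D [KD K0K Kx DD0]]] := derivation_adjoin_seq char0 [seq ev 'X_j | j <- enum 'I_m] KD0.
have {}Kx j : K (ev 'X_j) by apply: Kx; apply/mapP; exists j; rewrite ?mem_enum.
have hC c : K (ev c%:MP) /\ D (ev c%:MP) = 0.
  have -> : ev c%:MP = ev (c%:MP \mPo f) by rewrite comp_mpolyC.
  have Kc : exists P, ev (c%:MP \mPo f) = ev (P \mPo f) by exists c%:MP.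
  split; first exact: K0K.
  by rewrite DD0 // hD0 mderivC comp_mpoly0 rmorph0.
have chain h : K (ev h) /\ D (ev h) = \sum_j ev h^`M(j) * D (ev 'X_j).
  elim/mpoly_gen_ind: h => [c|i|p r [Kp Dp] [Kr Dr]|p r [Kp Dp] [Kr Dr]].
  - have [Kc ->] := hC c; split=> //; rewrite big1 // => j _.
    by rewrite mderivC rmorph0 mul0r.
  - split=> //; rewrite (bigD1 i) //= big1 ?addr0 => [|j ji].
      by rewrite mderivXU eqxx rmorph1 mul1r.
    by rewrite mderivXU eq_sym (negbTE ji) rmorph0 mul0r.
  - split; first by rewrite rmorphD; apply: (der_addK KD).
    rewrite rmorphD (der_add KD) // Dp Dr -big_split; apply: eq_bigr => j _ /=.
    by rewrite mderivD rmorphD mulrDl.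
  - split; first by rewrite rmorphM; apply: (der_mulK KD).
    rewrite rmorphM (der_mul KD) // Dp Dr mulr_sumr mulr_suml -big_split.
    by apply: eq_bigr => j _ /=; rewrite mderivM rmorphD !rmorphM; ring.
exists (fun j => D (ev 'X_j)); split=> [h h0|i]; rewrite -(chain _).2.
  by rewrite h0; apply: der_zero KD.
have e : tnth f i = 'X_i \mPo f by rewrite comp_mpolyXU -tnth_nth.
rewrite e DD0; last by exists 'X_i.
by rewrite hD0 mderivXU !rmorph_nat.
Qed.

End DerivationLift.

(** * Residue field of a prime ideal *)

Section PrimeQuotient.
Local Open Scope quotient_scope.
Variables (R : comNzRingType) (S : R -> Prop).
Hypotheses (S0 : S 0) (S1 : ~ S 1) (SD : forall a b, S a -> S b -> S (a + b)).
Hypotheses (SM : forall a b, S b -> S (a * b)).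
Hypothesis (Sprime : forall a b, S (a * b) -> S a \/ S b).

Definition in_prime : R -> bool := fun x => boolp.asbool (S x).

Lemma in_prime_idealr : idealr_closed in_prime.
Proof.
split; [exact/boolp.asboolP|by apply/negP => /boolp.asboolP|].
move=> a u v /boolp.asboolP Su /boolp.asboolP Sv; apply/boolp.asboolP.
by apply: SD => //; apply: SM.
Qed.

HB.instance Definition _ := isIdealr.Build R in_prime in_prime_idealr.

Definition in_prime_ideal : idealr R := Idealr.clone R in_prime _.

Definition domain_quot := @Quotient.quot R in_prime_ideal.
HB.instance Definition _ := EqQuotient.on domain_quot.
HB.instance Definition _ := GRing.ComNzRing.on domain_quot.

(** Inverses are chosen classically, to equip the quotient with the unit structure that is part of
    an integral domain before fractions are taken. *)
Lemma domain_quot_inv : {inv : domain_quot -> domain_quot &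
  forall x, (exists y, y * x = 1) -> inv x * x = 1 }.
Proof.
apply: (@boolp.choice _ _ (fun x z : domain_quot => (exists y, y * x = 1) -> z * x = 1)).
move=> x; have [[y e]|no] := boolp.EM (exists y, y * x = 1); first by exists y.
by exists 0 => /no.
Qed.

Definition domain_quot_unit (x : domain_quot) : bool := boolp.asbool (exists y, y * x = 1).
Definition domain_quot_invr (x : domain_quot) : domain_quot :=
  if domain_quot_unit x then projT1 domain_quot_inv x else x.

Lemma domain_quot_mulVr : {in domain_quot_unit, left_inverse 1 domain_quot_invr *%R}.
Proof.
move=> x ux; rewrite /domain_quot_invr; move: (ux); rewrite -topredE /= => ->.
by apply: (projT2 domain_quot_inv); apply/boolp.asboolP.
Qed.

Lemma domain_quot_unitP x y : y * x = 1 -> domain_quot_unit x.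
Proof. by move=> e; apply/boolp.asboolP; exists y. Qed.

Lemma domain_quot_inv_out : {in [predC domain_quot_unit], domain_quot_invr =1 id}.
Proof. by move=> x; rewrite inE /domain_quot_invr -topredE /= => /negbTE ->. Qed.

HB.instance Definition _ := GRing.ComNzRing_hasMulInverse.Build domain_quot
  domain_quot_mulVr domain_quot_unitP domain_quot_inv_out.

Lemma domain_quot_pi_eq0 a : ((\pi a : domain_quot) == 0) = in_prime a.
Proof.
rewrite -(rmorph0 (\pi : R -> domain_quot)) eqmodE /= Quotient.equivE subr0 //.
Qed.

Lemma domain_quot_mulf_eq0 (x y : domain_quot) : x * y = 0 -> (x == 0) || (y == 0).
Proof.
move=> /eqP; rewrite -[x]reprK -[y]reprK -rmorphM !domain_quot_pi_eq0.
by move=> /boolp.asboolP/Sprime[] h; apply/orP; [left|right]; apply/boolp.asboolP.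
Qed.

HB.instance Definition _ := GRing.ComUnitRing_isIntegral.Build domain_quot domain_quot_mulf_eq0.

Lemma prime_fraction_field : exists (L : fieldType) (ev : {rmorphism R -> L}),
  forall a, ev a = 0 <-> S a.
Proof.
exists {fraction domain_quot}, (@tofrac domain_quot \o (\pi : R -> domain_quot)) => a /=.
split=> [/eqP|Sa]; first by rewrite tofrac_eq0 domain_quot_pi_eq0 => /boolp.asboolP.
by apply/eqP; rewrite tofrac_eq0 domain_quot_pi_eq0; apply/boolp.asboolP.
Qed.
End PrimeQuotient.

(** * Generic points and the Jacobian criterion *)

Section PrimeAvoidance.
Variables (R : comNzRingType) (W I : R -> Prop).
Hypotheses (W1 : W 1) (WM : forall a b, W a -> W b -> W (a * b)).

Definition is_ideal (A : R -> Prop) :=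
  [/\ A 0, forall a b, A a -> A b -> A (a + b) & forall a b, A b -> A (a * b)].

Hypotheses (Iideal : is_ideal I) (IW : forall a, I a -> W a -> False).

Let good (A : R -> Prop) :=
  [/\ is_ideal A, forall a, I a -> A a & forall a, A a -> W a -> False].

Lemma maximal_avoiding_ideal : exists A, good A /\
  forall B, good B -> (forall a, A a -> B a) -> forall a, B a -> A a.
Proof.
pose Q (A : R -> Prop) := (forall x, ~ A x) \/ good A.
have [] := @classical_sets.Zorn_bigcup R Q.
  move=> F FQ Ftot.
  have [[A0 [FA0 gA0]]|noF] := boolp.EM (exists A, F A /\ good A); last first.
    left=> x [A FA Ax]; case: (FQ A FA) => [/(_ x)//|gA].
    by apply: noF; exists A.
  right; have goodF A x : F A -> A x -> good A.
    by move=> FA Ax; case: (FQ A FA) => // /(_ x).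
  split; [split|move=> a Ia|].
  - by exists A0 => //; case: gA0 => -[].
  - move=> a b [A FA Aa] [B FB Bb].
    have gA := goodF A a FA Aa; have gB := goodF B b FB Bb.
    case: (Ftot A B FA FB) => sAB.
      by exists B => //; case: gB => -[_ + _ _ _]; apply=> //; apply: sAB.
    by exists A => //; case: gA => -[_ + _ _ _]; apply=> //; apply: sAB.
  - move=> a b [A FA Aa]; exists A => //.
    by case: (goodF A b FA Aa) => -[_ _ + _ _]; apply.
  - by exists A0 => //; case: gA0 => _ + _; apply.
  - by move=> a [A FA Aa]; case: (goodF A a FA Aa) => _ _; apply.
move=> A [[Aempty|gA] Amax].
  case: (Amax I).
    split; first by move=> x /Aempty.
    by move=> /(_ 0)/(_ _)/Aempty; apply; case: Iideal.
  by right; split.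
exists A; split=> // B gB sAB a Ba; apply: boolp.contrapT => nAa.
by apply: (Amax B); [split=> // /(_ a Ba)|right].
Qed.

(** An ideal maximal among those disjoint from [W] is prime: if a and b lie outside it, the ideals
    enlarged by a and by b both meet [W], and the product of two such elements lies in the ideal as
    soon as ab does. *)
Lemma prime_avoiding : exists A, [/\ is_ideal A, forall a, I a -> A a,
  forall a, A a -> W a -> False & forall a b, A (a * b) -> A a \/ A b].
Proof.
have [A [[Aid sIA AW] Amax]] := maximal_avoiding_ideal.
have [A0 AD AM] := Aid.
exists A; split=> // a b Aab.
have key c : ~ A c -> exists x y, A y /\ W (x * c + y).
  move=> nAc; pose B z := exists x y, A y /\ z = x * c + y.
  apply: boolp.contrapT => no; apply: nAc; apply: (Amax B).
  - split; [split|move=> z /sIA Az|].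
    + by exists 0, 0; rewrite mul0r addr0.
    + move=> _ _ [x [y [Ay ->]]] [x' [y' [Ay' ->]]].
      by exists (x + x'), (y + y'); split; [apply: AD|ring].
    + move=> z _ [x [y [Ay ->]]].
      by exists (z * x), (z * y); split; [apply: AM|ring].
    + by exists 0, z; rewrite mul0r add0r.
    + by move=> _ [x [y [Ay ->]]] Wz; apply: no; exists x, y.
  - by move=> z Az; exists 0, z; rewrite mul0r add0r.
  - by exists 1, 0; rewrite mul1r addr0.
apply: boolp.contrapT => no.
have [x [y [Ay Wx]]] : exists x y, A y /\ W (x * a + y).
  by apply: key => Aa; apply: no; left.
have [x' [y' [Ay' Wx']]] : exists x y, A y /\ W (x * b + y).
  by apply: key => Ab; apply: no; right.
apply: (AW ((x * a + y) * (x' * b + y'))); last exact: WM.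
have -> : (x * a + y) * (x' * b + y') = x * x' * (a * b) + ((x' * b + y') * y + (x * a) * y').
  by ring.
by apply: (AD); [apply: (AM)|apply: (AD); apply: (AM)].
Qed.

Lemma avoiding_field : exists (L : fieldType) (ev : {rmorphism R -> L}),
  (forall a, I a -> ev a = 0) /\ (forall a, W a -> ev a != 0).
Proof.
have [A [[A0 AD AM] sIA AW Apr]] := prime_avoiding.
have A1 : ~ A 1 by move=> /AW; apply.
have [L [ev hev]] := prime_fraction_field A0 A1 AD AM Apr.
exists L, ev; split=> [a /sIA/hev//|a Wa].
by apply/negP => /eqP/hev Aa; apply: (AW a).
Qed.

End PrimeAvoidance.

(** The multiplicative set consists of the nonzero polynomials in f. A prime containing [I] and
    avoiding it defines an irreducible subvariety on which f stays independent, and [ev] is its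
    generic point; the zero set of [I] itself may be reducible. *)
Lemma generic_point (k : fieldType) m d (I : {mpoly k[m]} -> Prop)
    (f : d.-tuple {mpoly k[m]}) : is_ideal I ->
  (forall P : {mpoly k[d]}, I (P \mPo f) -> P = 0) ->
  exists (L : fieldType) (ev : {rmorphism {mpoly k[m]} -> L}),
    (forall h, I h -> ev h = 0) /\ forall P : {mpoly k[d]}, ev (P \mPo f) = 0 -> P = 0.
Proof.
move=> Iid indep.
have [|||L [ev [evI evW]]] := @avoiding_field _
  (fun h => exists2 P : {mpoly k[d]}, P != 0 & h = P \mPo f) I _ _ Iid _.
- by exists 1; rewrite ?oner_neq0 // comp_mpoly1.
- move=> _ _ [P P0 ->] [Q Q0 ->]; exists (P * Q); first by rewrite mulf_neq0.
  by rewrite rmorphM.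
- by move=> _ /[swap] -[P /eqP P0 ->] /indep.
exists L, ev; split=> // P eP; apply/eqP/negPn/negP => P0.
by have /eqP := evW _ (ex_intro2 _ _ P P0 erefl); apply.
Qed.

Section Jacobian.
Variables (k : fieldType) (char0 : [pchar k] =i pred0).

Definition jacobian n d (f : d.-tuple {mpoly k[n]}) : 'M[{mpoly k[n]}]_(d, n) :=
  \matrix_(i, j) (tnth f i)^`M(j).

(** The Jacobian criterion: the columns of [W] are the lifts of the derivations d/df_q to the
    generic point of affine space. *)
Lemma jacobian_right_inverse n d (f : d.-tuple {mpoly k[n]}) :
  (forall P : {mpoly k[d]}, P \mPo f = 0 -> P = 0) ->
  exists W : 'M[{fraction {mpoly k[n]}}]_(n, d),
    map_mx (@tofrac _) (jacobian f) *m W = 1%:M.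
Proof.
move=> indep; have [|W hW] := @derivation_lift k _ n d (@tofrac {mpoly k[n]}) f _ char0.
  by move=> P /eqP; rewrite tofrac_eq0 => /eqP/indep.
exists W^T; apply/matrixP => i q; rewrite !mxE -(hW q).2.
by apply: eq_bigr => j _; rewrite !mxE.
Qed.

Lemma alg_indep_le n d (f : d.-tuple {mpoly k[n]}) :
  (forall P : {mpoly k[d]}, P \mPo f = 0 -> P = 0) -> (d <= n)%N.
Proof.
move=> /jacobian_right_inverse[W e]; rewrite -(@mxrank1 {fraction {mpoly k[n]}} d) -e.
by apply: leq_trans (mxrankM_maxr _ _) _; rewrite rank_leq_row.
Qed.

End Jacobian.

(** * Polynomials in the last variable *)

Lemma mmap_ext (R : nzRingType) (S : comNzRingType) n (g : R -> S) (u v : 'I_n -> S) :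
  u =1 v -> mmap g u =1 mmap g v.
Proof.
move=> uv p; rewrite /mmap; apply: eq_bigr => m _; congr (_ * _).
by apply: eq_bigr => i _; rewrite uv.
Qed.

Lemma mpoly_rmorph_ext (R S : comNzRingType) n (f g : {rmorphism {mpoly R[n]} -> S}) :
  (forall c, f c%:MP = g c%:MP) -> (forall i, f 'X_i = g 'X_i) -> f =1 g.
Proof.
move=> hC hX; elim/mpoly_gen_ind => [//|//|p q hp hq|p q hp hq].
  by rewrite !rmorphD hp hq.
by rewrite !rmorphM hp hq.
Qed.

Section SplitLast.
Variables (k : comNzRingType) (n : nat) (c : 'I_n -> k).

(** Besides singling out the last variable T, the substitution contains the shear sending each other
    X_j to X_j + c_j T, which Noether normalisation uses to make a polynomial monic in T. *)
Definition split_var (i : 'I_n.+1) : {poly {mpoly k[n]}} :=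
  if unlift ord_max i is Some j then ('X_j)%:P + (c j)%:MP%:P * 'X else 'X.

Definition split_last (p : {mpoly k[n.+1]}) : {poly {mpoly k[n]}} :=
  mmap (polyC \o @mpolyC n k) split_var p.

HB.instance Definition _ := GRing.RMorphism.copy split_last
  (mmap (polyC \o @mpolyC n k) split_var).

Definition unsplit_coef (p : {mpoly k[n]}) : {mpoly k[n.+1]} :=
  mmap (@mpolyC n.+1 k) (fun j => 'X_(lift ord_max j) - (c j)%:MP * 'X_ord_max) p.

HB.instance Definition _ := GRing.RMorphism.copy unsplit_coef
  (mmap (@mpolyC n.+1 k) (fun j => 'X_(lift ord_max j) - (c j)%:MP * 'X_ord_max)).

Definition unsplit_last (p : {poly {mpoly k[n]}}) : {mpoly k[n.+1]} :=
  (map_poly unsplit_coef p).['X_ord_max].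

HB.instance Definition _ := GRing.RMorphism.copy unsplit_last
  (horner_eval 'X_ord_max \o map_poly unsplit_coef).

Lemma split_lastD : {morph split_last : p q / p + q}.
Proof. exact: rmorphD. Qed.

Lemma split_lastB : {morph split_last : p q / p - q}.
Proof. exact: rmorphB. Qed.

Lemma split_lastM : {morph split_last : p q / p * q}.
Proof. exact: rmorphM. Qed.

Lemma unsplit_lastD : {morph unsplit_last : p q / p + q}.
Proof. exact: rmorphD. Qed.

Lemma unsplit_lastM : {morph unsplit_last : p q / p * q}.
Proof. exact: rmorphM. Qed.

Lemma split_lastC a : split_last a%:MP = a%:MP%:P.
Proof. by rewrite /split_last mmapC. Qed.

Lemma split_lastX i : split_last 'X_i = split_var i.
Proof. by rewrite /split_last mmapX mmap1U. Qed.

Lemma unsplit_lastC a : unsplit_last a%:P = unsplit_coef a.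
Proof. by rewrite /unsplit_last map_polyC hornerC. Qed.

Lemma unsplit_lastX : unsplit_last 'X = 'X_ord_max.
Proof. by rewrite /unsplit_last map_polyX hornerX. Qed.

Lemma split_lastK : cancel split_last unsplit_last.
Proof.
apply: (@mpoly_rmorph_ext _ _ _ (unsplit_last \o split_last) idfun) => [a|i] /=.
  by rewrite split_lastC unsplit_lastC /unsplit_coef mmapC.
rewrite split_lastX /split_var; case: unliftP => [j|] ->; last exact: unsplit_lastX.
rewrite unsplit_lastD unsplit_lastM unsplit_lastX !unsplit_lastC.
by rewrite /unsplit_coef mmapC mmapX mmap1U subrK.
Qed.

Lemma unsplit_lastK : cancel unsplit_last split_last.
Proof.
have hC : forall a, split_last (unsplit_last a%:P) = a%:P.
  apply: (@mpoly_rmorph_ext _ _ _ (split_last \o unsplit_last \o polyC) polyC) => [a|i] /=.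
    by rewrite unsplit_lastC /unsplit_coef mmapC split_lastC.
  rewrite unsplit_lastC /unsplit_coef mmapX mmap1U split_lastB split_lastM split_lastC !split_lastX.
  by rewrite /split_var liftK unlift_none /= addrK.
elim/poly_ind => [|p a IHp]; first by rewrite !rmorph0.
rewrite unsplit_lastD unsplit_lastM split_lastD split_lastM IHp unsplit_lastX hC.
by rewrite split_lastX /split_var unlift_none.
Qed.

Lemma mmap_split (S : comNzRingType) (g : {rmorphism k -> S}) (v : 'I_n.+1 -> S) p :
  mmap g v p =
  (map_poly (mmap g (fun j => v (lift ord_max j) - g (c j) * v ord_max)) (split_last p)).[v ord_max].
Proof.
set h := fun j => _; move: p.
apply: (@mpoly_rmorph_ext _ _ _ (mmap g v)
  (horner_eval (v ord_max) \o map_poly (mmap g h) \o split_last)) => [a|i] /=.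
  by rewrite split_lastC map_polyC /horner_eval hornerC /= !mmapC.
rewrite split_lastX mmapX mmap1U /split_var /horner_eval; case: unliftP => [j|] ->.
  rewrite rmorphD rmorphM /= !map_polyC map_polyX !hornerE /= mmapX mmap1U mmapC.
  by rewrite /h subrK.
by rewrite map_polyX hornerX.
Qed.

End SplitLast.

(** In characteristic 0 the numbers below [size p] are distinct, and there is one more of them than
    the degree of p. *)
Lemma poly_nonroot (k : fieldType) : [pchar k] =i pred0 ->
  forall p : {poly k}, p != 0 -> exists t, p.[t] != 0.
Proof.
move=> char0 p p0; apply: boolp.contrapT => no.
pose s := [seq (i%:R : k) | i <- iota 0 (size p)].
have /(max_poly_roots p0) : all (root p) s.
  apply/allP => t _; apply/negPn/negP => pt; apply: no; exists t; exact: pt.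
have -> : uniq s.
  rewrite map_inj_uniq ?iota_uniq // => i j e; wlog ij : i j e / (i <= j)%N.
    by move=> hw; case/orP: (leq_total i j) => [/hw->//|/hw->].
  have /eqP := subrr (i%:R : k); rewrite {1}e -natrB // ((pcharf0P k).1 char0).
  by rewrite subn_eq0 => ji; apply/eqP; rewrite eqn_leq ij.
by rewrite size_map size_iota ltnn => /(_ isT).
Qed.

Lemma mpoly0_const (R : nzRingType) (p : {mpoly R[0]}) : p = (p@_0)%:MP.
Proof.
apply/mpolyP => m; have -> : m = 0%MM by apply/mnmP => -[].
by rewrite mcoeffC eqxx mulr1.
Qed.

Lemma meval_nonzero (k : fieldType) : [pchar k] =i pred0 ->
  forall n (p : {mpoly k[n]}), p != 0 -> exists v : 'I_n -> k, p.@[v] != 0.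
Proof.
move=> char0; elim=> [|n IHn] p p0.
  exists (fun=> 0); apply: contraNneq p0.
  by rewrite (mpoly0_const p) mevalC => ->; rewrite mpolyC0.
pose q := split_last (fun=> 0) p.
have q0 : q != 0.
  apply: contraNneq p0 => e; rewrite -(split_lastK (fun=> 0) p).
  by rewrite -/q e rmorph0.
have /IHn[v hv] : lead_coef q != 0 by rewrite lead_coef_eq0.
have /(poly_nonroot char0)[t ht] : map_poly (meval v) q != 0.
  apply: contraNneq hv => /(congr1 (fun h : {poly k} => h`_(size q).-1)).
  by rewrite coef_map coef0 /= => ->.
exists (fun i => if unlift ord_max i is Some j then v j else t).
rewrite /meval (mmap_split (fun=> 0)) unlift_none -/q.
rewrite (_ : map_poly _ q = map_poly (meval v) q) //.
apply: eq_map_poly => a; rewrite /meval; apply: mmap_ext => j.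
by rewrite liftK /= mul0r subr0.
Qed.

(** * Chains of primes and algebraic independence *)

Section PrimeChains.
Variables (k : fieldType) (n : nat) (A : {mpoly k[n]} -> Prop).
Hypotheses (AC : forall c, A c%:MP) (AD : forall p q, A p -> A q -> A (p + q)).
Hypothesis AM : forall p q, A p -> A q -> A (p * q).

Lemma comp_mpoly_in d (a : d.-tuple {mpoly k[n]}) : (forall i, A (tnth a i)) ->
  forall Q, A (Q \mPo a).
Proof.
move=> Aa; elim/mpoly_gen_ind => [c|i|p q hp hq|p q hp hq].
- by rewrite comp_mpolyC.
- by rewrite comp_mpolyXU -tnth_nth.
- by rewrite rmorphD; apply: AD.
- by rewrite rmorphM; apply: AM.
Qed.

(** Induct from the top of the chain. Given elements independent modulo P_1, adjoin some x in P_1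
    outside P_0. In a relation modulo P_0, the constant coefficient with respect to x is a relation
    modulo P_1, hence zero; then x can be cancelled because P_0 is prime. *)
Lemma prime_chain_indep d (P : nat -> {mpoly k[n]} -> Prop) :
  (forall i, (i <= d)%N -> prime_ideal_of A (P i)) ->
  (forall i, (i < d)%N -> (forall a, P i a -> P i.+1 a) /\ (exists a, P i.+1 a /\ ~ P i a)) ->
  exists a : d.-tuple {mpoly k[n]}, (forall i, A (tnth a i)) /\
    forall Q : {mpoly k[d]}, P 0%N (Q \mPo a) -> Q = 0.
Proof.
elim: d P => [|d IHd] P Ppr Pinc.
  exists [tuple]; split=> [[]//|Q]; rewrite (mpoly0_const Q) comp_mpolyC.
  move: (Q@_0) => c Pc; have [->|c0] := eqVneq c 0; first by rewrite mpolyC0.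
  case: (Ppr 0%N isT) => _ [_ _ PM] P1 _; case: P1.
  by rewrite -mpolyC1 -(mulVf c0) mpolyCM; apply: PM.
have [||a [Aa aindep]] := IHd (fun i => P i.+1); [by move=> i hi; apply: Ppr|by move=> i hi; apply: Pinc|].
have [sub01 [x [P1x nP0x]]] := Pinc 0%N isT.
have [P1A [_ P1D P1M] _ _] := Ppr 1%N isT.
have [_ _ _ P0pr] := Ppr 0%N isT.
pose b := [tuple if unlift ord_max i is Some j then tnth a j else x | i < d.+1].
exists b; split=> [i|Q].
  by rewrite tnth_mktuple; case: unliftP => [j|] _ //; apply: P1A.
have Aev q : A (map_poly (comp_mpoly a) q).[x].
  elim/poly_ind: q => [|q c IHq]; first by rewrite rmorph0 horner0 -mpolyC0.
  rewrite rmorphD rmorphM /= map_polyX map_polyC !hornerE /=; apply: AD; last exact: comp_mpoly_in.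
  by apply: AM => //; apply: P1A.
have key q : P 0%N (map_poly (comp_mpoly a) q).[x] -> q = 0.
  elim/poly_ind: q => [//|q c IHq].
  rewrite rmorphD rmorphM /= map_polyX map_polyC !hornerE /= => h.
  have c0 : c = 0.
    apply: aindep; rewrite -[_ \mPo _](addKr ((map_poly (comp_mpoly a) q).[x] * x)).
    apply: P1D; last exact: sub01.
    rewrite -mulN1r mulrA; apply: P1M => //; apply: AM => //.
    by rewrite -mpolyC1 -mpolyCN.
  move: h; rewrite c0 rmorph0 addr0 => /P0pr[||/IHq->|//]; rewrite ?Aev ?mul0r ?addr0 //.
  exact: P1A.
rewrite /comp_mpoly (mmap_split (fun=> 0)) tnth_mktuple unlift_none => h.
rewrite -(split_lastK (fun=> 0) Q) [split_last _ _]key ?rmorph0 //.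
move: h; congr (P 0%N _.[x]); apply: eq_map_poly => p; apply: mmap_ext => j.
by rewrite /= tnth_mktuple liftK mpolyC0 mul0r subr0.
Qed.

(** The d independent elements obtained from the chain are polynomials in the r generators, and
    these d polynomials in r variables are themselves independent. *)
Lemma krull_dim_le r (F : r.-tuple {mpoly k[n]}) d : [pchar k] =i pred0 ->
  free_generators A F -> prime_chain A d -> (d <= r)%N.
Proof.
move=> char0 [_ Agen] [P [Ppr Pinc]].
have [a [Aa aindep]] := prime_chain_indep Ppr Pinc.
have /boolp.choice[Q hQ] i : exists Q : {mpoly k[r]}, tnth a i = Q \mPo F by apply/Agen.
apply: (@alg_indep_le _ char0 r d [tuple Q i | i < d]) => H H0; apply: aindep.
have -> : H \mPo a = (H \mPo [tuple Q i | i < d]) \mPo F.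
  move: H {H0}; apply: (@mpoly_rmorph_ext _ _ _ (comp_mpoly a)
    (comp_mpoly F \o comp_mpoly [tuple Q i | i < d])) => [c|i] /=.
    by rewrite !comp_mpolyC.
  by rewrite !comp_mpolyXU -!tnth_nth tnth_mktuple.
by rewrite H0 rmorph0; case: (Ppr 0%N isT) => _ [].
Qed.

End PrimeChains.

(** * Regular sequences and elimination *)

Section RegularSequences.
Variable R : comNzRingType.
Implicit Types (s : seq R) (x y h : R).

Fixpoint in_span s y : Prop :=
  if s is h :: s' then exists c, in_span s' (y - c * h) else y = 0.

(* Weakly regular, with the sequence read from right to left: the quotient by
   the ideal is allowed to vanish. *)
Fixpoint regseq s : Prop :=
  if s is h :: s' then regseq s' /\ forall y, in_span s' (h * y) -> in_span s' y
  else True.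

Lemma in_span_ideal s : is_ideal (in_span s).
Proof.
elim: s => [|h s [s0 sD sM]] /=.
  by split=> [//|a b -> ->|a b ->]; rewrite ?addr0 ?mulr0.
split=> [|a b [c Hc] [c' Hc']|a b [c Hc]].
- by exists 0; rewrite mul0r subr0.
- exists (c + c'); rewrite (_ : _ - _ = (a - c * h) + (b - c' * h)); last by ring.
  exact: sD.
- exists (a * c); rewrite (_ : _ - _ = a * (b - c * h)); last by ring.
  exact: sM.
Qed.

Lemma regseq_ones c : regseq (nseq c 1).
Proof. by elim: c => //= c IHc; split=> // y; rewrite mul1r. Qed.

End RegularSequences.

Section RegularTransport.
Variables (R S : comNzRingType) (phi : {rmorphism R -> S}) (psi : {rmorphism S -> R}).
Hypotheses (phiK : cancel phi psi) (psiK : cancel psi phi).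

Lemma in_span_transport s y : in_span (map phi s) y <-> in_span s (psi y).
Proof.
elim: s y => [|h s IHs] y /=; first by split=> [->|/(congr1 phi)]; rewrite ?psiK rmorph0.
split=> -[c] Hc; [exists (psi c)|exists (phi c)].
  by move: Hc; rewrite IHs rmorphB rmorphM phiK.
by rewrite IHs rmorphB rmorphM !phiK.
Qed.

Lemma regseq_transport s : regseq s -> regseq (map phi s).
Proof.
elim: s => //= h s IHs [/IHs rs reg]; split=> // y.
by rewrite !in_span_transport rmorphM phiK => /reg.
Qed.

End RegularTransport.

Section RegularPoly.
Variable B : comNzRingType.

Lemma in_span_polyC (s : seq B) (y : {poly B}) :
  in_span (map polyC s) y <-> forall i, in_span s y`_i.
Proof.
elim: s y => [|h s IHs] y /=.
  split=> [-> i|y0]; first by rewrite coef0.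
  by apply/polyP => i; rewrite coef0.
split=> [[c] /IHs Hc i|/boolp.choice[c Hc]].
  by exists c`_i; have := Hc i; rewrite coefB coefMC.
exists (\poly_(i < size y) c i); apply/IHs => i.
rewrite coefB coefMC coef_poly; case: ifP => // /negbT; rewrite -leqNgt => yi.
rewrite nth_default // mul0r subr0; have [] // := in_span_ideal s.
Qed.

Lemma regseq_polyC (s : seq B) : regseq s -> regseq (map polyC s).
Proof.
elim: s => //= h s IHs [/IHs rs reg]; split=> // y.
by rewrite !in_span_polyC => Hy i; apply: reg; have := Hy i; rewrite coefCM.
Qed.

(** Treat the coefficients of y from the top down. With d the degree of f, the coefficient of f y in
    degree d + i is y_i plus multiples of higher coefficients of y, already known to lie in the
    span. *)
Lemma monic_regular (s : seq B) (f : {poly B}) : f \is monic ->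
  forall y, in_span (map polyC s) (f * y) -> in_span (map polyC s) y.
Proof.
move=> fm y; rewrite !in_span_polyC => Hfy.
have [A0 AD AM] := in_span_ideal s.
have key N : forall i, (size y <= i + N)%N -> in_span s y`_i.
  elim: N => [|N IHN] i hi; first by rewrite nth_default // -(addn0 i).
  pose d := (size f).-1.
  have fd : f`_d = 1 by apply/eqP; rewrite -lead_coefE -monicE.
  have := Hfy (d + i)%N; rewrite coefM.
  have hd : (d < (d + i).+1)%N by lia.
  rewrite (bigD1 (Ordinal hd)) //= fd mul1r addKn => H.
  rewrite -[y`_i](addrK (\sum_(j < (d + i).+1 | j != Ordinal hd) f`_j * y`_(d + i - j))).
  apply: (AD) => //; rewrite -mulN1r; apply: (AM).
  apply: (big_ind (in_span s)) => [|a b|j jd]; [exact: A0|exact: AD|].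
  have {jd} : (j != d :> nat) by exact: jd.
  rewrite neq_ltn => /orP[jd|jd].
    by apply: (AM); apply: IHN; lia.
  by rewrite nth_default ?mul0r //; apply: leq_trans (leqSpred _) jd.
by move=> i; apply: (key (size y)); rewrite leq_addl.
Qed.

End RegularPoly.

(** * Elimination of one variable over an algebraically closed field *)

Section Elimination.
Variables (k : closedFieldType) (B : comNzRingType).
Variables (e : {rmorphism B -> k}) (iota : {rmorphism k -> B}).
Hypothesis iotaK : cancel iota e.
Variables (J : {poly B} -> Prop) (Jid : is_ideal J) (F : {poly B}).
Hypotheses (JF : J F) (Fm : F \is monic).

(** The element a is the resultant of F and g, as the determinant of multiplication by g on the free
    module B[T]/(F) with basis 1, T, ..., T^(d-1). If g specialises to the constant u, that matrix
    specialises to the scalar matrix u. *)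
Lemma elim_det (g : {poly B}) (u : k) : J g -> map_poly e g = u%:P ->
  exists a, J a%:P /\ exists d, e a = u ^+ d.
Proof.
move=> Jg gu; have [J0 JD JM] := Jid.
pose d := (size F).-1.
have sF : size F = d.+1.
  by rewrite /d prednK // size_poly_gt0 monic_neq0.
have [d0|d_gt0] := posnP d.
  exists 1; split; last by exists 0%N; rewrite rmorph1 expr0.
  suff <- : F = 1%:P by [].
  have := size1_polyC (eq_leq (etrans sF (congr1 S d0))) => e1.
  by rewrite e1; congr (_%:P); have := monicP Fm; rewrite e1 lead_coefC coefC.
pose q (i : 'I_d) := Pdiv.Ring.rdivp ('X^i * g) F.
pose r (i : 'I_d) := Pdiv.Ring.rmodp ('X^i * g) F.
have qr (i : 'I_d) : 'X^i * g = q i * F + r i by exact: Pdiv.RingMonic.rdivp_eq.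
have sr i : (size (r i) <= d)%N.
  by rewrite -ltnS -sF Pdiv.Ring.ltn_rmodp monic_neq0.
pose M := \matrix_(i < d, j < d) (r i)`_j.
pose tau : 'cV[{poly B}]_d := \col_i 'X^i.
have Mtau i : J ((map_mx polyC M *m tau) i 0).
  rewrite mxE (_ : \sum_j _ = r i); last first.
    have -> : r i = \poly_(j < d) (r i)`_j.
      apply/polyP => j; rewrite coef_poly; case: ltnP => // dj.
      by rewrite nth_default // (leq_trans (sr i)).
    by rewrite poly_def; apply: eq_bigr => j _; rewrite !mxE mul_polyC.
  rewrite -[r i](addKr (q i * F)) -qr addrC.
  by apply: (JD); [apply: (JM)|rewrite -mulNr; apply: (JM)].
exists (\det M); split.
  (* The entries of M tau lie in J. Row 0 of adj(M) M tau = det(M) tau is det(M) itself because the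
     first entry of tau is 1. *)
  have := congr1 (fun A : 'M_d => (A *m tau) (Ordinal d_gt0) 0) (mul_adj_mx (map_mx polyC M)).
  rewrite mul_scalar_mx -mulmxA det_map_mx [RHS]mxE [X in _ * X]mxE expr0 mulr1 => <-.
  by rewrite mxE; apply: (big_ind J) => [|a b|i _]; [exact: J0|exact: JD|]; apply: (JM); apply: Mtau.
exists d; rewrite -det_map_mx -det_scalar; congr (\det _).
apply/matrixP => i j; rewrite !mxE -coef_map.
suff -> : map_poly e (r i) = u *: 'X^i.
  by rewrite coefZ coefXn mulr_natr eq_sym.
have Fem : size (map_poly e F) = d.+1 by rewrite size_map_poly_id0 ?sF // (monicP Fm) rmorph1 oner_neq0.
have := congr1 (map_poly e) (qr i).
rewrite rmorphM rmorphD rmorphM /= map_polyXn gu mulrC mul_polyC.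
move=> /(congr1 (fun p => p %% map_poly e F)).
rewrite modp_small ?modp_addl_mul_small ?Fem ?ltnS //.
  by rewrite (leq_trans (size_poly _ _)).
by rewrite (leq_trans (size_scale_leq _ _)) // size_polyXn.
Qed.

(** The specialised ideal in k[T] is generated by an element of least degree. Were that element a
    nonzero constant, [elim_det] would give an element of the elimination ideal not killed by [e];
    otherwise its root is a common zero. *)
Lemma elimination : (forall a, J a%:P -> e a = 0) ->
  exists t, forall g, J g -> (map_poly e g).[t] = 0.
Proof.
move=> Je; apply: boolp.contrapT => no; have [J0 JD JM] := Jid.
have no' t : exists2 g, J g & (map_poly e g).[t] != 0.
  apply: boolp.contrapT => no'; apply: no; exists t => g Jg; apply/eqP/negPn/negP => gt.
  by apply: no'; exists g.
have [|n [[g [Jg g0 sg]] nmin]] := @nat_least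
    (fun n => exists g, [/\ J g, map_poly e g != 0 & size (map_poly e g) = n]).
  have [g Jg g0] := no' 0; exists (size (map_poly e g)), g; split=> //.
  by apply: contraNneq g0 => ->; rewrite horner0.
have [/eqP g1|] := boolP (size (map_poly e g) == 1%N).
  have eg := size1_polyC (eq_leq g1).
  have [a [/Je ea [d ead]]] := elim_det Jg eg.
  move/eqP: ead; rewrite ea eq_sym expf_eq0 => /andP[_ /eqP u0].
  by move: g0; rewrite eg u0 polyC0 eqxx.
move=> /closed_rootP[t gt]; have [h Jh ht] := no' t.
(* The quotient, computed in k[T], is carried back to B[T] by [iota], so that h' stays in J while
   specialising to the remainder. *)
pose h' := h - map_poly iota (map_poly e h %/ map_poly e g) * g.
have eh' : map_poly e h' = map_poly e h %% map_poly e g.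
  rewrite rmorphB rmorphM /= -map_poly_comp map_poly_id => [|x _]; last exact: iotaK.
  by rewrite {1}(divp_eq (map_poly e h) (map_poly e g)) addrC addKr.
have h'0 : map_poly e h' != 0.
  apply: contraNneq ht; rewrite eh' => h0.
  by rewrite (divp_eq (map_poly e h) (map_poly e g)) h0 addr0 hornerM (eqP gt) mulr0.
have : (n <= size (map_poly e h'))%N.
  apply: nmin; exists h'; split=> //.
  by apply: (JD) => //; rewrite -mulNr; apply: JM.
by rewrite -sg leqNgt eh' ltn_modp g0.
Qed.

End Elimination.

Section TopCoefficient.
Variable R : comNzRingType.

(** The coefficient u may be zero, so tops multiply without any condition on leading
    coefficients. *)
Definition has_top (p : {poly R}) (d : nat) (u : R) := (size p <= d.+1)%N /\ p`_d = u.

Lemma has_top_mul p q d e u v : has_top p d u -> has_top q e v ->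
  has_top (p * q) (d + e) (u * v).
Proof.
move=> [sp pd] [sq qe]; split; first by rewrite (leq_trans (size_polyMleq _ _)) //; lia.
rewrite coefM; have hd : (d < (d + e).+1)%N by lia.
rewrite (bigD1 (Ordinal hd)) //= addKn pd qe big1 ?addr0 // => j jd.
have {jd} : (j != d :> nat) by exact: jd.
rewrite neq_ltn => /orP[jd|jd]; last by rewrite [p`_j]nth_default ?mul0r // (leq_trans sp).
by rewrite [q`_ _]nth_default ?mulr0 // (leq_trans sq) //; lia.
Qed.

Lemma has_top1 : has_top 1 0 1.
Proof. by rewrite /has_top size_poly1 coef1. Qed.

Lemma has_top_exp p d u e : has_top p d u -> has_top (p ^+ e) (d * e) (u ^+ e).
Proof.
move=> hp; elim: e => [|e IHe]; first by rewrite !expr0 muln0; apply: has_top1.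
by rewrite !exprS mulnS; apply: has_top_mul.
Qed.

Lemma has_top_prod I (s : seq I) (F : I -> {poly R}) (d : I -> nat) (u : I -> R) :
  (forall i, has_top (F i) (d i) (u i)) ->
  has_top (\prod_(i <- s) F i) (\sum_(i <- s) d i)%N (\prod_(i <- s) u i).
Proof.
move=> hF; elim: s => [|i s IHs]; first by rewrite !big_nil; apply: has_top1.
by rewrite !big_cons; apply: has_top_mul.
Qed.

End TopCoefficient.

(** * Noether normalisation: monic in the last variable after a shear *)

Section Normalization.
Variables (k : fieldType) (n : nat).

Definition top_form (f : {mpoly k[n.+1]}) d : {mpoly k[n.+1]} :=
  \sum_(m <- msupp f | mdeg m == d) f@_m *: 'X_[m].

Definition point_at_1 (a : 'I_n -> k) (i : 'I_n.+1) : k :=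
  if unlift ord_max i is Some j then a j else 1.

Lemma split_last_sum (a : 'I_n -> k) I (r : seq I) (F : I -> {mpoly k[n.+1]}) :
  split_last a (\sum_(i <- r) F i) = \sum_(i <- r) split_last a (F i).
Proof. exact: raddf_sum. Qed.

Lemma split_monomial_top (a : 'I_n -> k) (m : 'X_{1..n.+1}) :
  has_top (split_last a 'X_[m]) (mdeg m) ('X_[m].@[point_at_1 a])%:MP.
Proof.
rewrite /split_last mmapX mevalX mdegE rmorph_prod; apply: has_top_prod => i.
rewrite rmorphXn -[m i in X in has_top _ X]mul1n; apply: has_top_exp.
rewrite /split_var /point_at_1; case: unliftP => [j|] _.
  split; last by rewrite coefD coefC coefMX coefC add0r.
  rewrite (leq_trans (size_polyD _ _)) // geq_max (leq_trans (size_polyC_leq1 _)) //.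
  rewrite (leq_trans (size_polyMleq _ _)) // size_polyX addn2 /=.
  by rewrite ltnS size_polyC_leq1.
by split; rewrite ?size_polyX ?coefX ?mpolyC1.
Qed.

(** After the shear, T^d can only come from the terms of degree d, each variable contributing its
    multiple of T; hence the coefficient is the top form at (a, 1). *)
Lemma split_last_top (a : 'I_n -> k) f d : (forall m, m \in msupp f -> (mdeg m <= d)%N) ->
  has_top (split_last a f) d ((top_form f d).@[point_at_1 a])%:MP.
Proof.
move=> hd.
have e : split_last a f = \sum_(m <- msupp f) (f@_m)%:MP%:P * split_last a 'X_[m].
  rewrite {1}[f]mpolyE split_last_sum; apply: eq_bigr => m _.
  by rewrite -mul_mpolyC split_lastM split_lastC.
split.
  rewrite e; apply: (leq_trans (size_sum _ _ _)); apply/bigmax_leqP_seq => m hm _.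
  rewrite mul_polyC (leq_trans (size_scale_leq _ _)) //.
  by rewrite (leq_trans (split_monomial_top a m).1) // ltnS hd.
rewrite e coef_sum /top_form (raddf_sum (meval _)) (raddf_sum (@mpolyC n k)) /=.
rewrite [RHS]big_mkcond big_seq [RHS]big_seq; apply: eq_bigr => m hm.
rewrite coefCM; case: eqVneq => [<-|md].
  by rewrite (split_monomial_top a m).2 mevalZ mpolyCM.
rewrite nth_default ?mulr0 // (leq_trans (split_monomial_top a m).1) //.
by rewrite ltn_neqAle md hd.
Qed.

Lemma top_form_homog f d t (v : 'I_n.+1 -> k) :
  (top_form f d).@[fun i => t * v i] = t ^+ d * (top_form f d).@[v].
Proof.
rewrite /top_form !(raddf_sum (meval _)) /= mulr_sumr; apply: eq_bigr => m /eqP <-.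
rewrite !mevalZ !mevalX mulrCA; congr (_ * _); rewrite mdegE expr_sum -big_split.
by apply: eq_bigr => i _; rewrite exprMn.
Qed.

Lemma monic_coordinates f : [pchar k] =i pred0 -> f != 0 ->
  exists (a : 'I_n -> k) (c : k), c != 0 /\ c%:MP *: split_last a f \is monic.
Proof.
move=> char0 f0; pose d := mdeg (mlead f).
have hd m : m \in msupp f -> (mdeg m <= d)%N.
  by move=> /msize_mdeg_lt; rewrite -mlead_deg // ltnS.
have top0 : top_form f d != 0.
  apply/negP => /eqP /(congr1 (mcoeff (mlead f))); rewrite mcoeff0 /top_form raddf_sum /=.
  rewrite big_mkcond (bigD1_seq (mlead f)) ?mlead_supp ?msupp_uniq //= eqxx.
  rewrite mcoeffZ mcoeffX eqxx mulr1 big1 ?addr0 => [/eqP|m mm].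
    by rewrite mleadc_eq0 (negbTE f0).
  by case: ifP => // _; rewrite mcoeffZ mcoeffX (negbTE mm) mulr0.
(* The extra factor makes the last coordinate of v nonzero, so that v can be rescaled to the shape
   (a, 1) by homogeneity. *)
have [|v] := @meval_nonzero _ char0 _ (top_form f d * 'X_ord_max).
  rewrite mulf_neq0 //; apply/eqP => /(congr1 (mcoeff U_(ord_max)%MM)) /eqP.
  by rewrite mcoeffX eqxx mcoeff0 oner_eq0.
rewrite mevalM mevalXU mulf_eq0 negb_or => /andP[hv vmax].
pose a j := (v ord_max)^-1 * v (lift ord_max j).
pose u := (top_form f d).@[point_at_1 a].
have u0 : u != 0.
  have -> : u = (v ord_max) ^- d * (top_form f d).@[v].
    rewrite -exprVn -top_form_homog; apply: meval_eq => i.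
    by rewrite /point_at_1; case: unliftP => [j|] -> //; rewrite mulVf.
  by rewrite mulf_neq0 // invr_eq0 expf_neq0.
exists a, u^-1; rewrite invr_eq0 u0; split=> //.
have [sf fd] := split_last_top a hd.
have lf : lead_coef (split_last a f) = u%:MP.
  rewrite lead_coefE; suff -> : size (split_last a f) = d.+1 by [].
  apply/eqP; rewrite eqn_leq sf ltnNge; apply/negP => sfd.
  move: fd; rewrite nth_default // => /eqP; rewrite eq_sym mpolyC_eq0 -/u.
  by rewrite (negbTE u0).
rewrite monicE -mul_polyC lead_coefM lead_coefC lf -mpolyCM mulVf // mpolyC1 //.
Qed.

End Normalization.

Section CodimRegular.
Variables (k : closedFieldType) (char0 : [pchar k] =i pred0).

Definition zero_set n (J : {mpoly k[n]} -> Prop) (x : 'rV[k]_n) : Prop :=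
  forall f, J f -> f.@[x 0] = 0.

Lemma dim_ge_full n : dim_ge (fun _ : 'rV[k]_n => True) n.
Proof.
exists [tuple 'X_i | i < n] => P; rewrite comp_mpoly_id => hP.
apply/eqP/negPn/negP => /(meval_nonzero char0)[v /negP]; apply.
by rewrite -(meval_eq (v1 := (\row_i v i) 0)) ?hP // => i; rewrite mxE.
Qed.

(** Make some nonzero f in J monic in the last variable and let J' be the elimination ideal. By
    [elimination] every zero of J' lifts to a zero of J, so the zero set of J' has no larger
    dimension, in a space of one dimension less. A regular sequence for J' stays regular after
    adjoining the variable, and a monic polynomial is regular modulo it. *)
Lemma codim_regseq c n (J : {mpoly k[n]} -> Prop) : is_ideal J ->
  (forall d, dim_ge (zero_set J) d -> (d + c <= n)%N) ->
  exists s, [/\ size s = c, forall h, h \in s -> J h & regseq s].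
Proof.
elim: c n J => [|c IHc] n J Jid Jdim; first by exists [::].
have [J0 JD JM] := Jid.
have [f Jf f0] : exists2 f, J f & f != 0.
  apply: boolp.contrapT => no.
  have Jz h : J h -> h = 0.
    by move=> Jh; apply/eqP/negPn/negP => h0; apply: no; exists h.
  suff /Jdim : dim_ge (zero_set J) n by lia.
  have [g hg] := @dim_ge_full n; exists g => P hP; apply: hg => x _.
  by apply: hP => h /Jz ->; rewrite meval0.
case: n J Jid J0 JD JM Jdim f Jf f0 => [|n] J Jid J0 JD JM Jdim f Jf f0.
  (* Without variables J contains a nonzero constant; the sequence of ones is then available because
     regularity is weak. *)
  have J1 : J 1.
    rewrite (mpoly0_const f) in Jf f0; move: (f@_0) Jf f0 => u Jf.
    by rewrite mpolyC_eq0 => u0; rewrite -mpolyC1 -(mulVf u0) mpolyCM; apply: JM.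
  exists (nseq c.+1 1); split; rewrite ?size_nseq //; last exact: regseq_ones.
  by move=> h /nseqP[->].
have [a [u [u0 um]]] := monic_coordinates char0 f0.
pose Jt (p : {poly {mpoly k[n]}}) := J (unsplit_last a p).
have Jtid : is_ideal Jt.
  split=> [|p q|p q]; rewrite /Jt ?rmorph0 //.
    by rewrite unsplit_lastD; apply: JD.
  by rewrite unsplit_lastM; apply: JM.
have JF : Jt (u%:MP *: split_last a f).
  by rewrite /Jt -mul_polyC unsplit_lastM split_lastK; apply: JM.
pose J' q := Jt q%:P.
have J'id : is_ideal J'.
  have [Jt0 JtD JtM] := Jtid; split=> [//|p q|p q]; rewrite /J'.
    by rewrite polyCD; apply: JtD.
  by rewrite polyCM; apply: JtM.
have lift_point x' : zero_set J' x' -> exists x, zero_set J x /\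
    forall q, (unsplit_last a q%:P).@[x 0] = q.@[x' 0].
  move=> zx'; have [||t ht] := @elimination k _ (meval (x' 0)) (@mpolyC n k) _ Jt Jtid _ JF um.
    by move=> y /=; rewrite mevalC.
    by [].
  pose x := \row_i (if unlift ord_max i is Some j then x' 0 j + a j * t else t) : 'rV[k]_n.+1.
  have ev p : p.@[x 0] = (map_poly (meval (x' 0)) (split_last a p)).[t].
    have xt : x 0 ord_max = t by rewrite mxE unlift_none.
    rewrite {1}/meval (mmap_split a) xt; congr _.[_].
    apply: eq_map_poly => q; apply: mmap_ext => j.
    by rewrite !mxE liftK /= addrK.
  exists x; split=> [h Jh|q].
    by rewrite ev ht // /Jt split_lastK.
  by rewrite ev unsplit_lastK map_polyC hornerC.
have [|s [ss Js rs]] := IHc n J' J'id.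
  move=> d [g hg]; suff /Jdim : dim_ge (zero_set J) d by lia.
  exists [tuple unsplit_last a (tnth g i)%:P | i < d] => P hP; apply: hg => x' /lift_point[x [zx hx]].
  rewrite -(hP x zx) !comp_mpoly_meval; apply: meval_eq => i.
  by rewrite tnth_mktuple hx.
exists (map (unsplit_last a) (u%:MP *: split_last a f :: map polyC s)); split.
- by rewrite /= !size_map ss.
- move=> h; rewrite inE => /orP[/eqP->//|/mapP[_ /mapP[q qs ->] ->]]; exact: Js.
- apply: (regseq_transport (unsplit_lastK a) (split_lastK a)) => /=; split.
    exact: regseq_polyC.
  exact: monic_regular.
Qed.

End CodimRegular.

(** * Bordered determinants *)

Section Bordered.
Variables (S : idomainType) (n l : nat).
Implicit Types (P : 'M[S]_n) (A B C D : 'M[S]_(n, l)).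

Definition bordered P A B : 'M[S]_(n + l) := block_mx P A B^T 0.

Lemma det0_mulmx m (M : 'M[S]_m) (v : 'cV[S]_m) : \det M != 0 -> M *m v = 0 -> v = 0.
Proof.
move=> d0 Mv; have := congr1 (fun w => \adj M *m w) Mv.
rewrite mulmx0 mulmxA mul_adj_mx mul_scalar_mx => /matrixP e.
apply/matrixP => i j; have /eqP := e i j.
by rewrite !mxE mulf_eq0 (negbTE d0) => /eqP.
Qed.

Lemma bordered_adj P A B : let H := dlsubmx (\adj (bordered P A B)) in
  let G := ulsubmx (\adj (bordered P A B)) in
  P *m G + A *m H = (\det (bordered P A B))%:M.
Proof.
move=> H G; have := mul_mx_adj (bordered P A B).
rewrite -[\adj _]submxK {1}/bordered mulmx_block scalar_mx_block.
by move=> /eq_block_mx[].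
Qed.

(** Let H and G be the left blocks of the adjugate of [bordered P A B]. Multiplying P G + A H = M by
    D^T gives D^T A H = M D^T. The adjugate times [bordered P C B] is block triangular with diagonal
    blocks M and H C. Taking determinants and eliminating det(H C) yields the identity up to a power
    of M. *)
Lemma bordered_swap_nz P A B C D : D^T *m P = 0 -> \det (bordered P A B) != 0 ->
  \det (bordered P A B) * \det (D^T *m C) = \det (bordered P C B) * \det (D^T *m A).
Proof.
move=> DP; set M := \det _ => M0.
pose H := dlsubmx (\adj (bordered P A B)); pose G := ulsubmx (\adj (bordered P A B)).
have DAH : D^T *m A *m H = M *: D^T.
  have := congr1 (fun N => D^T *m N) (bordered_adj P A B).
  by rewrite mulmxDr !mulmxA DP mul0mx add0r mul_mx_scalar.
have dHC : \det (D^T *m A) * \det (H *m C) = M ^+ l * \det (D^T *m C).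
  by rewrite -det_mulmx mulmxA DAH -scalemxAl detZ.
have adjC : \det (\adj (bordered P A B)) * \det (bordered P C B) = M ^+ n * \det (H *m C).
  have := mul_adj_mx (bordered P A B).
  rewrite -[\adj _]submxK -/H -/G {1}/bordered mulmx_block scalar_mx_block -/M.
  move=> /eq_block_mx[e1 _ e2 _].
  rewrite -det_mulmx {1}/bordered mulmx_block e1 e2 !mulmx0 !addr0.
  by rewrite det_ublock det_scalar.
have adjA : \det (\adj (bordered P A B)) * M = M ^+ (n + l).
  by rewrite -det_mulmx mul_adj_mx det_scalar.
have Mnl : M ^+ (n + l) != 0 by rewrite expf_neq0.
apply: (mulfI Mnl).
have -> : M ^+ (n + l) * (\det (bordered P C B) * \det (D^T *m A)) =
    M * (\det (\adj (bordered P A B)) * \det (bordered P C B)) * \det (D^T *m A).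
  by rewrite -adjA; ring.
rewrite adjC -(mulrA M) -(mulrA (M ^+ n)) (mulrC (\det (H *m C))) dHC exprD; ring.
Qed.

Lemma bordered_swap_l P A B C D : D^T *m P = 0 ->
  \det (bordered P A B) * \det (D^T *m C) = \det (bordered P C B) * \det (D^T *m A).
Proof.
move=> DP; have [A0|An0] := eqVneq (\det (bordered P A B)) 0; last exact: bordered_swap_nz.
have [C0|Cn0] := eqVneq (\det (bordered P C B)) 0; first by rewrite A0 C0 !mul0r.
by rewrite -(@bordered_swap_nz P C B A).
Qed.

Lemma bordered_tr P A B : (bordered P A B)^T = bordered P^T B A.
Proof. by rewrite /bordered tr_block_mx trmxK trmx0. Qed.

Lemma bordered_swap_r P A B C D : P *m D = 0 ->
  \det (bordered P A B) * \det (D^T *m C) = \det (bordered P A C) * \det (D^T *m B).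
Proof.
move=> PD; rewrite -(det_tr (bordered P A B)) -(det_tr (bordered P A C)) !bordered_tr.
by apply: bordered_swap_l; rewrite -trmx_mul PD trmx0.
Qed.

(** The adjugate gives P(GX) + A(HX) = M X; applying D^T leaves D^T A (HX) = 0, so HX = 0. *)
Lemma bordered_image P A B D (X : 'cV[S]_n) : D^T *m P = 0 -> D^T *m X = 0 ->
  \det (D^T *m A) != 0 -> exists Y, P *m Y = \det (bordered P A B) *: X.
Proof.
move=> DP DX q0.
pose H := dlsubmx (\adj (bordered P A B)); pose G := ulsubmx (\adj (bordered P A B)).
have e : P *m (G *m X) + A *m (H *m X) = \det (bordered P A B) *: X.
  by rewrite !mulmxA -mulmxDl bordered_adj mul_scalar_mx.
exists (G *m X); rewrite -e (_ : H *m X = 0) ?mulmx0 ?addr0 //.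
apply: (det0_mulmx q0); have := congr1 (fun N => D^T *m N) e.
by rewrite -scalemxAr DX scaler0 mulmxDr !mulmxA DP !mul0mx add0r.
Qed.

(** By Cramer's rule u makes det(D^T B) Y - D u vanish under B^T; P kills it too, so the invertible
    bordered matrix kills it padded by zeros. *)
Lemma bordered_kernel P A B D (Y : 'cV[S]_n) : P *m D = 0 -> P *m Y = 0 ->
  \det (bordered P A B) != 0 -> exists u, D *m u = \det (D^T *m B) *: Y.
Proof.
move=> PD PY M0; exists (\adj (B^T *m D) *m (B^T *m Y)).
set u : 'cV_l := _ *m (_ *m _); apply/esym/eqP; rewrite -subr_eq0; apply/eqP.
have : col_mx (\det (D^T *m B) *: Y - D *m u) (0 : 'cV_l) = 0.
  apply: (det0_mulmx M0); rewrite /bordered mul_block_col !mulmx0 !addr0.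
  rewrite !mulmxBr -!scalemxAr PY !mulmxA PD !mul0mx scaler0 subr0.
  rewrite mul_mx_adj mul_scalar_mx -scalemxAl -(det_tr (D^T *m B)) trmx_mul trmxK subrr.
  by rewrite col_mx0.
by rewrite -col_mx0 => /eq_col_mx[].
Qed.

End Bordered.

(** * Degrees of minors and differentials *)

Section Homogeneity.
Variable k : fieldType.

(** The factor t on the left expresses degree d - 1 without a subtraction that would truncate at d =
    0; powers of t serve the same purpose in the next lemmas. *)
Lemma mderiv_homog n d (f : {mpoly k[n]}) j t (x : 'I_n -> k) : f \is d.-homog ->
  t * f^`M(j).@[fun z => t * x z] = t ^+ d * f^`M(j).@[x].
Proof.
move=> /dhomogP fd; rewrite /mderiv !(raddf_sum (meval _)) /= !mulr_sumr.
rewrite big_seq [RHS]big_seq; apply: eq_bigr => m /fd hd.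
rewrite !mevalZ; have [->|mj] := eqVneq (m j) 0%N; first by rewrite !mul0r !mulr0.
rewrite mulrCA [RHS]mulrCA; congr (_ * _).
have -> : d = (mdeg (m - U_(j))%MM).+1.
  by rewrite -hd /= -{1}(@submK _ U_(j)%MM m) ?lep1mP // mdegD mdeg1 addn1.
rewrite exprS -mulrA; congr (_ * _).
rewrite !mevalX mdegE expr_sum -big_split.
by apply: eq_bigr => i _; rewrite exprMn.
Qed.

Lemma bordered_scale n l (P : 'M[k]_n) (A B : 'M[k]_(n, l)) t :
  \det (bordered (t *: P) A B) * t ^+ l = t ^+ n * \det (bordered P A B).
Proof.
have -> : t ^+ l = \det (block_mx 1%:M 0 0 t%:M : 'M_(n + l)).
  by rewrite det_ublock det1 mul1r det_scalar.
have -> : t ^+ n = \det (block_mx t%:M 0 0 1%:M : 'M_(n + l)).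
  by rewrite det_ublock det1 mulr1 det_scalar.
rewrite -!det_mulmx /bordered !mulmx_block !(mulmx0, mul0mx, mulmx1, mul1mx, addr0, add0r).
by rewrite mul_scalar_mx mul_scalar_mx mul_mx_scalar.
Qed.

(** M and cM scale alike, so c is constant along a ray through a point where M is nonzero; as an
    identity of polynomials in t this persists at t = 0 and gives c(x) = c(0). *)
Lemma constant_quotient (char0 : [pchar k] =i pred0) n a b (c M : {mpoly k[n]}) : M != 0 ->
  (forall t x, c.@[fun z => t * x z] * M.@[fun z => t * x z] * t ^+ a = t ^+ b * (c.@[x] * M.@[x])) ->
  (forall t x, M.@[fun z => t * x z] * t ^+ a = t ^+ b * M.@[x]) ->
  c = (c.@[fun=> 0])%:MP.
Proof.
move=> M0 hN hM; apply/eqP; rewrite -subr_eq0; apply/negPn/negP => c0.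
have /(meval_nonzero char0)[x] : (c - (c.@[fun=> 0])%:MP) * M != 0 by rewrite mulf_neq0.
rewrite mevalM mulf_eq0 negb_or mevalB mevalC => /andP[cx Mx].
pose u : {poly k} := mmap polyC (fun i => (x i)%:P * 'X) c - (c.@[x])%:P.
have hu t : u.[t] = c.@[fun z => t * x z] - c.@[x].
  rewrite /u !hornerE; congr (_ - _).
  apply: (@mpoly_rmorph_ext _ _ _ (horner_eval t \o mmap polyC (fun i => (x i)%:P * 'X))
    (meval (fun z => t * x z))) => [d|i] /=; rewrite /horner_eval.
    by rewrite mmapC mevalC hornerC.
  by rewrite mmapX mmap1U mevalXU !hornerE mulrC.
have u0 : u = 0.
  suff /eqP : u * 'X^b = 0 by rewrite mulf_eq0 expf_eq0 polyX_eq0 andbF orbF => /eqP.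
  apply/eqP/negPn/negP => /(poly_nonroot char0)[t /negP]; apply; apply/eqP.
  rewrite hornerM hornerXn hu; apply: (mulIf Mx); rewrite mul0r.
  have := hN t x; rewrite -mulrA hM => e.
  by rewrite mulrBl mulrBl -mulrA e; ring.
have := hu 0; rewrite u0 horner0 (meval_eq (v2 := fun=> 0)) => [/esym/eqP|z]; last by rewrite mul0r.
by rewrite subr_eq0 eq_sym -subr_eq0 (negbTE cx).
Qed.

End Homogeneity.

Lemma full_minor (k : fieldType) (char0 : [pchar k] =i pred0) n l (F : l.-tuple {mpoly k[n]}) :
  (forall P : {mpoly k[l]}, P \mPo F = 0 -> P = 0) ->
  exists A : 'M[k]_(n, l), \det (jacobian F *m map_mx (@mpolyC n k) A) != 0.
Proof.
move=> /(jacobian_right_inverse char0)[W e].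
pose T := (map_mx (@tofrac _) (jacobian F))^T.
have Tfull : row_full T.
  rewrite /row_full eqn_leq rank_leq_col /= mxrank_tr -{1}(@mxrank1 {fraction {mpoly k[n]}} l) -e.
  exact: mxrankM_maxl.
pose f := fullrankfun Tfull.
exists (\matrix_(i, j) (i == f j)%:R).
have -> : jacobian F *m map_mx (@mpolyC n k) (\matrix_(i, j) (i == f j)%:R) = colsub f (jacobian F).
  apply/matrixP => i j; rewrite !mxE (bigD1 (f j)) //= !mxE eqxx mpolyC1 mulr1 big1 ?addr0 //.
  by move=> z zf; rewrite !mxE (negbTE zf) mpolyC0 mulr0.
rewrite -tofrac_eq0 -det_map_mx -det_tr -unitfE -unitmxE.
have -> : (map_mx (@tofrac _) (colsub f (jacobian F)))^T = rowsub f T.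
  by apply/matrixP => i j; rewrite !mxE.
exact: fullrowsub_unit.
Qed.

(** * Exactness of the complex *)

Lemma in_span1 (R : comNzRingType) (a y : R) : in_span [:: a] y <-> exists c, y = c * a.
Proof.
by split=> -[c] /= e; exists c; [apply/eqP; rewrite -subr_eq0 e|rewrite e subrr].
Qed.

Lemma regseq_neq0 (S : idomainType) (h1 h2 : S) : regseq [:: h2; h1] -> h1 != 0.
Proof.
move=> [[_ reg1] _]; apply/eqP => h10.
have /eqP : in_span [::] (1 : S) by apply: reg1; rewrite /= h10 mul0r.
by rewrite oner_eq0.
Qed.

(** The fraction x/a has both h1 and h2 as denominators; a regular pair shares no denominator, so
    x/a lies in the ring. *)
Lemma regular_cancel (S : idomainType) (h1 h2 a x : S) : a != 0 -> regseq [:: h2; h1] ->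
  (exists y, h1 * x = y * a) -> (exists y, h2 * x = y * a) -> exists y, x = y * a.
Proof.
move=> a0 reg [y1 e1] [y2 e2]; have h1_neq0 := regseq_neq0 reg; have [_ reg2] := reg.
have [|c ey1] := (in_span1 h1 y1).1.
  apply: reg2; apply/in_span1; exists y2; apply: (mulIf a0).
  by rewrite -mulrA -e1 mulrCA e2; ring.
exists c; apply: (mulfI h1_neq0).
by rewrite e1 ey1; ring.
Qed.

Lemma scaler_colI (S : idomainType) (h : S) p (u v : 'cV[S]_p) : h != 0 -> h *: u = h *: v -> u = v.
Proof.
move=> h0 /matrixP e; apply/matrixP => i j; apply: (mulfI h0).
by have := e i j; rewrite !mxE.
Qed.

Lemma regular_cancel_mx (S : idomainType) (h1 h2 : S) p (u1 u2 : 'cV[S]_p) :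
  regseq [:: h2; h1] -> h2 *: u1 = h1 *: u2 -> exists u, u1 = h1 *: u.
Proof.
move=> [_ reg2] e; have /boolp.choice[c hc] (j : 'I_p) : exists c, u1 j 0 = c * h1.
  apply/in_span1; apply: reg2; apply/in_span1; exists (u2 j 0).
  by have /matrixP/(_ j 0) := e; rewrite !mxE => ->; rewrite mulrC.
by exists (\col_j c j); apply/matrixP => j i; rewrite !mxE ord1 hc mulrC.
Qed.

Section Core.
Variables (k : closedFieldType) (char0 : [pchar k] =i pred0) (n l : nat).
Local Notation S := {mpoly k[n]}.
Variables (P : 'M[S]_n) (F : l.-tuple S) (deg : 'I_l -> nat).
Local Notation Jc := (jacobian F).
Local Notation cst := (map_mx (@mpolyC n k)).
Hypothesis Pskew : P^T = - P.
Hypothesis Plin : forall i j t (x : 'I_n -> k), (P i j).@[fun z => t * x z] = t * (P i j).@[x].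
Hypothesis JP : Jc *m P = 0.
Hypothesis Findep : forall Q : {mpoly k[l]}, Q \mPo F = 0 -> Q = 0.
Hypothesis Fhomog : forall i, tnth F i \is (deg i).-homog.
Hypothesis degsum : (2 * \sum_(i < l) deg i = n + l)%N.
Hypothesis full_rank : exists (A B : 'M[k]_(n, l)), \det (bordered P (cst A) (cst B)) != 0.
Hypothesis codim3 : forall d, dim_ge (fun x : 'rV[k]_n =>
  forall A B : 'M[k]_(n, l), (\det (bordered P (cst A) (cst B))).@[x 0] = 0) d -> (d + 3 <= n)%N.

Let M (A B : 'M[k]_(n, l)) := \det (bordered P (cst A) (cst B)).
Let q (A : 'M[k]_(n, l)) := \det (Jc *m cst A).

Let PJ : P *m Jc^T = 0.
Proof. by apply: trmx_inj; rewrite trmx_mul trmxK Pskew mulmxN JP oppr0 trmx0. Qed.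

Let swap A B A' B' : M A B * (q A' * q B') = M A' B' * (q A * q B).
Proof.
have e1 : M A B * q A' = M A' B * q A.
  by have := @bordered_swap_l _ _ _ P (cst A) (cst B) (cst A') Jc^T; rewrite trmxK; apply.
have e2 : M A' B * q B' = M A' B' * q B.
  by have := @bordered_swap_r _ _ _ P (cst A') (cst B) (cst B') Jc^T PJ; rewrite trmxK; apply.
move: (M A B) (M A' B) (M A' B') (q A) (q B) (q A') (q B') e1 e2 => x y z a d a' d' e1 e2.
by rewrite mulrA e1 mulrAC e2; ring.
Qed.

(** The ideal generated by the M A B, encoded as an intersection so that a property of its elements
    is checked on generators only. *)
Let J (h : S) := forall I, is_ideal I -> (forall A B, I (M A B)) -> I h.

Let Jideal : is_ideal J.
Proof.
split=> [I [I0 _ _]|a b Ja Jb I Iid IM|a b Jb I Iid IM] //.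
  by have [_ ID _] := Iid; apply: ID; [apply: Ja|apply: Jb].
by have [_ _ +] := Iid; apply; apply: Jb.
Qed.

Let J_ind I : is_ideal I -> (forall A B, I (M A B)) -> forall h, J h -> I h.
Proof. by move=> Iid IM h; apply. Qed.

Let regular3 : exists h1 h2 h3, [/\ J h1, J h2, J h3 & regseq [:: h3; h2; h1]].
Proof.
have [|[|h3 [|h2 [|h1 [|? ?]]]] [//= _ Jh rh]] := @codim_regseq k char0 3 n J Jideal.
  move=> d [g hg]; apply: codim3; exists g => Q hQ; apply: hg => x zx.
  by apply: hQ => A B; apply: zx => I Iid; apply.
by exists h1, h2, h3; split=> //; apply: Jh; rewrite !inE eqxx ?orbT.
Qed.

Let cstK (v : 'I_n -> k) (C : 'M[k]_(n, l)) : map_mx (meval v) (cst C) = C.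
Proof. by apply/matrixP => i j; rewrite !mxE mevalC. Qed.

Let M_scale A B t x : (M A B).@[fun z => t * x z] * t ^+ l = t ^+ n * (M A B).@[x].
Proof.
have ev (v : 'I_n -> k) : (M A B).@[v] = \det (bordered (map_mx (meval v) P) A B).
  rewrite /M -det_map_mx /bordered map_block_mx map_mx0.
  by rewrite -map_trmx !cstK.
rewrite !ev -bordered_scale; congr (\det (bordered _ _ _) * _).
by apply/matrixP => i j; rewrite !mxE Plin.
Qed.

Let q_scale A t x :
  (q A).@[fun z => t * x z] * t ^+ l = t ^+ (\sum_(i < l) deg i) * (q A).@[x].
Proof.
have ev (v : 'I_n -> k) : (q A).@[v] = \det (map_mx (meval v) Jc *m A).
  by rewrite /q -det_map_mx map_mxM cstK.
rewrite !ev mulrC -detZ scalemxAl.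
have -> : t *: map_mx (meval (fun z => t * x z)) Jc =
    diag_mx (\row_i t ^+ deg i) *m map_mx (meval x) Jc.
  apply/matrixP => i j; rewrite mul_diag_mx !mxE.
  exact: mderiv_homog.
rewrite -mulmxA det_mulmx det_diag; congr (_ * _).
by rewrite expr_sum; apply: eq_bigr => i _; rewrite mxE.
Qed.

Let minors : exists2 c : k, c != 0 & forall A B, q A * q B = c *: M A B.
Proof.
have [h1 [h2 [h3 [Jh1 Jh2 _ [reg _]]]]] := regular3.
have [A1 [B1 M11]] := full_rank.
have [A0 q0] := full_minor char0 Findep.
rewrite -/(q A0) in q0; rewrite -/(M A1 B1) in M11.
clearbody q M.
(* The fraction q_A1 q_B1 / M_A1B1 becomes polynomial after multiplication by any element of J: for
   a generator this is [swap]. Two regular elements of J then show that it is a polynomial c. *)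
have dvd : forall h, J h -> exists y, h * (q A1 * q B1) = y * M A1 B1.
  apply: J_ind; last by move=> A B; exists (q A * q B); rewrite swap mulrC.
  split=> [|a b [y e] [y' e']|a b [y e]]; first by exists 0; rewrite !mul0r.
    by exists (y + y'); rewrite !mulrDl e e'.
  by exists (a * y); rewrite -mulrA e mulrA.
have [c ec] := regular_cancel M11 reg (dvd _ Jh1) (dvd _ Jh2).
have rel A B : q A * q B = c * M A B.
  apply: (mulfI M11); rewrite -swap ec; ring.
have ev (v : 'I_n -> k) : c.@[v] * (M A1 B1).@[v] = (q A1).@[v] * (q B1).@[v].
  by rewrite -!mevalM ec.
have : c = (c.@[fun=> 0])%:MP.
  (* After multiplication by t^(2l), both M and q_A1 q_B1 scale by t^(n+l); for the product this is
     [degsum]. *)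
  apply: (@constant_quotient k char0 n (l + l) (n + l) c (M A1 B1) M11) => t x; last first.
    by rewrite exprD mulrA M_scale exprD; ring.
  rewrite ev ev.
  rewrite exprD.
  rewrite mulrACA.
  have e1 := q_scale A1 t x.
  have e2 := q_scale B1 t x.
  rewrite e1 e2.
  by rewrite mulrACA -exprD addnn -mul2n degsum.
move=> cE; exists c.@[fun=> 0] => [|A B]; last by rewrite rel {1}cE mul_mpolyC.
apply: contraNneq q0 => c0; have /eqP := rel A0 A0.
by rewrite cE c0 mpolyC0 mul0r mulf_eq0 orbb.
Qed.

Let image_M A B (X : 'cV[S]_n) : Jc *m X = 0 -> q A != 0 -> exists Y, M A B *: X = P *m Y.
Proof.
move=> JX qA; have [|||Y eY] := @bordered_image _ _ _ P (cst A) (cst B) Jc^T X; rewrite ?trmxK //.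
by exists Y.
Qed.

Let kernel_M A B (Y : 'cV[S]_n) : P *m Y = 0 -> M A B != 0 ->
  exists u, q B *: Y = Jc^T *m u.
Proof.
by move=> PY MAB; have [u] := bordered_kernel PJ PY MAB; rewrite trmxK => <-; exists u.
Qed.

Let Jc_inj (u : 'cV[S]_l) : Jc^T *m u = 0 -> u = 0.
Proof.
have [A0 q0] := full_minor char0 Findep.
move=> Ju; apply: (@det0_mulmx _ _ (Jc *m cst A0)^T); rewrite ?det_tr //.
by rewrite trmx_mul -mulmxA Ju mulmx0.
Qed.

(** Where M_AB is nonzero, q_B Y is in the image of D; multiplying by q_A and using q_A q_B = c M_AB
    replaces q_B by M_AB. So every h in J carries Y into the image, and injectivity of D lets two
    regular elements of J be cancelled. *)
Let kernel_exact (Y : 'cV[S]_n) : P *m Y = 0 -> exists u, Y = Jc^T *m u.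
Proof.
move=> PY; have [h1 [h2 [h3 [Jh1 Jh2 _ [reg _]]]]] := regular3.
have [c c0 rel] := minors.
have kerM := kernel_M PY; clearbody q M.
have inJ : forall h, J h -> exists u, h *: Y = Jc^T *m u.
  apply: J_ind => [|A B].
    split=> [|a b [u e] [v e']|a b [u e]]; first by exists 0; rewrite scale0r mulmx0.
      by exists (u + v); rewrite scalerDl mulmxDr e e'.
    by exists (a *: u); rewrite -scalerA e scalemxAr.
  have [->|MAB] := eqVneq (M A B) 0; first by exists 0; rewrite scale0r mulmx0.
  have [u eu] := kerM A B MAB.
  exists ((c^-1)%:MP *: (q A *: u)); rewrite -!scalemxAr -eu !scalerA; congr (_ *: _).
  by rewrite -mulrA rel -mul_mpolyC mulrA -mpolyCM mulVf // mpolyC1 mul1r.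
have [u1 e1] := inJ _ Jh1; have [u2 e2] := inJ _ Jh2.
have h10 := regseq_neq0 reg.
have [|u eu] := @regular_cancel_mx _ h1 h2 _ u1 u2 reg.
  apply/eqP; rewrite -subr_eq0; apply/eqP/Jc_inj.
  by rewrite mulmxBr -!scalemxAr -e1 -e2 !scalerA mulrC subrr.
exists u; apply: (scaler_colI h10).
by rewrite e1 eu scalemxAr.
Qed.

(** From h_i X = P Y_i, each h_j Y_i - h_i Y_j lies in ker P and equals D c_ij. The relation h3 c12
    = h2 c13 - h1 c23 and regularity of h3 modulo (h1, h2) put c12 in that ideal; correcting Y_1 and
    Y_2 by elements of the image of D then makes them compatible. *)
Lemma koszul_exact (X : 'cV[S]_n) : Jc *m X = 0 -> exists Y, X = P *m Y.
Proof.
move=> JX; have [h1 [h2 [h3 [Jh1 Jh2 Jh3 reg3]]]] := regular3.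
have [reg reg3'] := reg3.
have [c c0 rel] := minors.
have h10 := regseq_neq0 reg.
have imM := fun A B => @image_M A B X JX; clearbody q M.
have inJ : forall h, J h -> exists Y, h *: X = P *m Y.
  apply: J_ind => [|A B].
    split=> [|a b [u e] [v e']|a b [u e]]; first by exists 0; rewrite scale0r mulmx0.
      by exists (u + v); rewrite scalerDl mulmxDr e e'.
    by exists (a *: u); rewrite -scalerA e scalemxAr.
  have [MAB|MAB] := eqVneq (M A B) 0; first by exists 0; rewrite MAB scale0r mulmx0.
  have qA : q A != 0.
    have : q A * q B != 0 by rewrite rel -mul_mpolyC mulf_neq0 // mpolyC_eq0.
    by rewrite mulf_eq0 negb_or => /andP[].
  exact: imM.
have [Y1 e1] := inJ _ Jh1; have [Y2 e2] := inJ _ Jh2; have [Y3 e3] := inJ _ Jh3.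
have syz a b Y Y' : a *: X = P *m Y -> b *: X = P *m Y' ->
    exists v, b *: Y - a *: Y' = Jc^T *m v.
  move=> ea eb; apply: kernel_exact.
  by rewrite mulmxBr -!scalemxAr -ea -eb !scalerA mulrC subrr.
have [c12 f12] := syz _ _ _ _ e1 e2; have [c13 f13] := syz _ _ _ _ e1 e3.
have [c23 f23] := syz _ _ _ _ e2 e3.
have cocycle : h3 *: c12 = h2 *: c13 - h1 *: c23.
  apply/eqP; rewrite -subr_eq0; apply/eqP/Jc_inj.
  rewrite !mulmxBr -!scalemxAr -f12 -f13 -f23.
  by apply/matrixP => i j; rewrite !mxE; ring.
have /boolp.choice[a ha] (j : 'I_l) : exists a, in_span [:: h1] (c12 j 0 - a * h2).
  apply: reg3'; exists (c13 j 0); apply/in_span1; exists (- c23 j 0).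
  by have /matrixP/(_ j 0) := cocycle; rewrite !mxE => ->; ring.
have /boolp.choice[b hb] j : exists b, c12 j 0 - a j * h2 = b * h1 by apply/in_span1.
pose u1 : 'cV[S]_l := \col_j a j; pose u2 : 'cV[S]_l := \col_j - b j.
have ec : c12 = h2 *: u1 - h1 *: u2.
  by apply/matrixP => j i; rewrite !mxE ord1; have := hb j; move/eqP;
    rewrite subr_eq => /eqP ->; ring.
(* The corrected vectors satisfy h2 Y1' = h1 Y2', so Y1' = h1 Z. The corrections do not affect P Y_i
   because P D = 0. *)
have [|Z eZ] := @regular_cancel_mx _ h1 h2 _ (Y1 - Jc^T *m u1) (Y2 - Jc^T *m u2) reg.
  apply/eqP; rewrite -subr_eq0 !scalerBr opprD opprK addrACA f12 ec mulmxBr.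
  by rewrite -!scalemxAr addrACA subrr addNr addr0.
exists Z; apply: (scaler_colI h10).
by rewrite e1 scalemxAr -eZ mulmxBr mulmxA PJ mul0mx subr0.
Qed.

End Core.

(** * Differential calculus on an algebraic group *)

Section Calculus.
Variable k : fieldType.

Lemma mderiv_comp n p (f : {mpoly k[p]}) (A : polymap k n p) i :
  (f \mPo A)^`M(i) = \sum_j (f^`M(j) \mPo A) * (tnth A j)^`M(i).
Proof.
elim/mpoly_gen_ind: f => [c|j|f g hf hg|f g hf hg].
- rewrite comp_mpolyC mderivC big1 // => j _.
  by rewrite mderivC comp_mpoly0 mul0r.
- rewrite comp_mpolyXU -tnth_nth (bigD1 j) //= mderivXU eqxx comp_mpoly1 mul1r.
  by rewrite big1 ?addr0 // => z zj; rewrite mderivXU eq_sym (negbTE zj) comp_mpoly0 mul0r.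
- rewrite comp_mpolyD !mderivD hf hg -big_split; apply: eq_bigr => j _ /=.
  by rewrite mderivD comp_mpolyD mulrDl.
- rewrite rmorphM /= mderivM hf hg mulr_suml mulr_sumr -big_split; apply: eq_bigr => j _ /=.
  by rewrite mderivM comp_mpolyD !rmorphM /=; ring.
Qed.

Lemma pm_evalE n p (A : polymap k n p) x i : pm_eval A x 0 i = (tnth A i).@[x 0].
Proof. by rewrite mxE. Qed.

Lemma meval_comp n p (f : {mpoly k[p]}) (A : polymap k n p) (x : 'rV[k]_n) :
  (f \mPo A).@[x 0] = f.@[pm_eval A x 0].
Proof. by rewrite comp_mpoly_meval; apply: meval_eq => i; rewrite pm_evalE. Qed.

Lemma pm_eval_comp n p q (B : polymap k p q) (A : polymap k n p) x :
  pm_eval (pm_comp B A) x = pm_eval B (pm_eval A x).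
Proof. by apply/rowP => i; rewrite !mxE tnth_mktuple meval_comp. Qed.

Lemma pm_eval_id n x : pm_eval (pm_id k n) x = x.
Proof. by apply/rowP => i; rewrite !mxE tnth_mktuple mevalXU. Qed.

Lemma pm_eval_const n p (a : 'rV[k]_p) x : pm_eval (pm_const n a) x = a.
Proof. by apply/rowP => i; rewrite !mxE tnth_mktuple mevalC. Qed.

Lemma tnth_pairl n p q (A : polymap k n p) (B : polymap k n q) i :
  tnth (pm_pair A B) (lshift q i) = tnth A i.
Proof. exact: tnth_lshift. Qed.

Lemma tnth_pairr n p q (A : polymap k n p) (B : polymap k n q) i :
  tnth (pm_pair A B) (rshift p i) = tnth B i.
Proof. exact: tnth_rshift. Qed.

Lemma pm_eval_pair n p q (A : polymap k n p) (B : polymap k n q) x :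
  pm_eval (pm_pair A B) x = row_mx (pm_eval A x) (pm_eval B x).
Proof.
apply/rowP => i; rewrite pm_evalE; case: (splitP i) => j ij.
  have -> : i = lshift q j by apply: val_inj.
  by rewrite row_mxEl tnth_pairl pm_evalE.
have -> : i = rshift p j by apply: val_inj.
by rewrite row_mxEr tnth_pairr pm_evalE.
Qed.

Lemma dpolyD n (f g : {mpoly k[n]}) a v : dpoly (f + g) a v = dpoly f a v + dpoly g a v.
Proof.
by rewrite /dpoly -big_split; apply: eq_bigr => i _; rewrite mderivD mevalD mulrDl.
Qed.

Lemma dpolyN n (f : {mpoly k[n]}) a v : dpoly (- f) a v = - dpoly f a v.
Proof. by rewrite /dpoly -sumrN; apply: eq_bigr => i _; rewrite mderivN mevalN mulNr. Qed.

Lemma dpolyB n (f g : {mpoly k[n]}) a v : dpoly (f - g) a v = dpoly f a v - dpoly g a v.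
Proof. by rewrite dpolyD dpolyN. Qed.

Lemma dpolyC n c a v : dpoly (c%:MP : {mpoly k[n]}) a v = 0.
Proof. by rewrite /dpoly big1 // => i _; rewrite mderivC meval0 mul0r. Qed.

Lemma dpolyM n (f g : {mpoly k[n]}) a v :
  dpoly (f * g) a v = f.@[a 0] * dpoly g a v + dpoly f a v * g.@[a 0].
Proof.
rewrite /dpoly mulr_sumr mulr_suml -big_split; apply: eq_bigr => i _ /=.
by rewrite mderivM mevalD !mevalM; ring.
Qed.

Lemma dpoly_sum n I (r : seq I) (F : I -> {mpoly k[n]}) a v :
  dpoly (\sum_(i <- r) F i) a v = \sum_(i <- r) dpoly (F i) a v.
Proof.
elim: r => [|i r IHr]; first by rewrite !big_nil -mpolyC0 dpolyC.
by rewrite !big_cons dpolyD IHr.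
Qed.

Lemma dpolyZ n c (f : {mpoly k[n]}) a v : dpoly (c *: f) a v = c * dpoly f a v.
Proof. by rewrite -mul_mpolyC dpolyM dpolyC mul0r addr0 mevalC. Qed.

Lemma dpolyXU n i (a v : 'rV[k]_n) : dpoly 'X_i a v = v 0 i.
Proof.
rewrite /dpoly (bigD1 i) //= mderivXU eqxx meval1 mul1r big1 ?addr0 // => j ji.
by rewrite mderivXU eq_sym (negbTE ji) meval0 mul0r.
Qed.

Lemma dpoly_comp n p (f : {mpoly k[p]}) (A : polymap k n p) a v :
  dpoly (f \mPo A) a v = dpoly f (pm_eval A a) (pm_diff A a v).
Proof.
rewrite /dpoly; under eq_bigr => i _ do rewrite mderiv_comp (raddf_sum (meval _)) mulr_suml.
rewrite exchange_big; apply: eq_bigr => j _ /=.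
rewrite mxE /dpoly mulr_sumr; apply: eq_bigr => i _.
by rewrite mevalM meval_comp mulrA.
Qed.

Lemma pm_diffE n p (A : polymap k n p) a v i : pm_diff A a v 0 i = dpoly (tnth A i) a v.
Proof. by rewrite mxE. Qed.

Lemma pm_diff_comp n p q (B : polymap k p q) (A : polymap k n p) a v :
  pm_diff (pm_comp B A) a v = pm_diff B (pm_eval A a) (pm_diff A a v).
Proof. by apply/rowP => i; rewrite !mxE tnth_mktuple dpoly_comp. Qed.

Lemma pm_diff_id n a v : pm_diff (pm_id k n) a v = v.
Proof. by apply/rowP => i; rewrite !mxE tnth_mktuple dpolyXU. Qed.

Lemma pm_diff_const n p (c : 'rV[k]_p) a v : pm_diff (pm_const n c) a v = 0.
Proof. by apply/rowP => i; rewrite !mxE tnth_mktuple dpolyC. Qed.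

Lemma pm_diff_pair n p q (A : polymap k n p) (B : polymap k n q) a v :
  pm_diff (pm_pair A B) a v = row_mx (pm_diff A a v) (pm_diff B a v).
Proof.
apply/rowP => i; rewrite pm_diffE; case: (splitP i) => j ij.
  have -> : i = lshift q j by apply: val_inj.
  by rewrite row_mxEl tnth_pairl pm_diffE.
have -> : i = rshift p j by apply: val_inj.
by rewrite row_mxEr tnth_pairr pm_diffE.
Qed.

Lemma dpoly_is_linear n (f : {mpoly k[n]}) a c v w :
  dpoly f a (c *: v + w) = c * dpoly f a v + dpoly f a w.
Proof.
rewrite /dpoly mulr_sumr -big_split; apply: eq_bigr => i _ /=.
by rewrite !mxE; ring.
Qed.

Lemma dpoly_row_mx n p (f : {mpoly k[n + p]}) a v w :
  dpoly f a (row_mx v w) = \sum_i f^`M(lshift p i).@[a 0] * v 0 i +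
                           \sum_i f^`M(rshift n i).@[a 0] * w 0 i.
Proof.
by rewrite /dpoly big_split_ord; congr (_ + _); apply: eq_bigr => i _;
  rewrite ?row_mxEl ?row_mxEr.
Qed.

Lemma pm_diff_linear n p (A : polymap k n p) a c v w :
  pm_diff A a (c *: v + w) = c *: pm_diff A a v + pm_diff A a w.
Proof. by apply/rowP => i; rewrite !mxE dpoly_is_linear. Qed.

End Calculus.

Section Group.
Variables (k : fieldType) (G : affAlgGroup k).
Local Notation m := (ag_amb G).
Local Notation e := (ag_one G).
Local Notation mem := (@ag_mem k G).
Local Notation mul := (ag_mul G).
Local Notation inv := (ag_inv G).
Local Notation "g ** h" := (pm_eval mul (row_mx g h)) (at level 40, left associativity).
Local Notation iv g := (pm_eval inv g).

Lemma ag_mulgV g : mem g -> g ** (iv g) = e.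
Proof.
move=> hg; have hg' := ag_memV hg; have hg'' := ag_memV hg'.
rewrite -(ag_mul1 (ag_memM hg hg')) -(ag_mulV hg').
rewrite -ag_mulA ?(ag_mulA hg' hg) ?(ag_mulV hg) ?(ag_mul1 hg') ?(ag_mulV hg') //.
exact: ag_memM.
Qed.

Lemma ag_mulg1 g : mem g -> g ** e = g.
Proof.
move=> hg; have hg' := ag_memV hg.
by rewrite -{1}(ag_mulV hg) ag_mulA // ag_mulgV // ag_mul1.
Qed.

Lemma ag_invK g : mem g -> (iv (iv g)) = g.
Proof.
move=> hg; have hg' := ag_memV hg; have hg'' := ag_memV hg'.
by rewrite -{1}(ag_mulg1 hg'') -{1}(ag_mulV hg) ag_mulA // (ag_mulV hg') ag_mul1.
Qed.

Lemma ag_inv1 : (iv e) = e.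
Proof. by rewrite -{1}(ag_mulg1 (ag_memV (ag_mem1 G))) ag_mulV //; apply: ag_mem1. Qed.

Lemma ag_mulgK g h : mem g -> mem h -> (g ** (iv h)) ** h = g.
Proof. by move=> hg hh; rewrite -ag_mulA ?(ag_mulV hh) ?ag_mulg1 //; apply: ag_memV. Qed.

Lemma ag_invM g h : mem g -> mem h -> (iv (g ** h)) = (iv h) ** (iv g).
Proof.
move=> hg hh; have hg' := ag_memV hg; have hh' := ag_memV hh; have hgh := ag_memM hg hh.
have hx := ag_memM hh' hg'; have hy := ag_memV hgh.
rewrite -(ag_mulg1 hy) -(_ : (g ** h) ** ((iv h) ** (iv g)) = e).
  by rewrite ag_mulA // (ag_mulV hgh) ag_mul1.
by rewrite -ag_mulA // (ag_mulA hh hh' hg') ag_mulgV // ag_mul1 // ag_mulgV.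
Qed.

Definition vanish (f : {mpoly k[m]}) := vanishes_on mem f.

(** The group laws hold on G and not on the ambient space, so they may be differentiated along
    tangent vectors only; this lemma is the tool for doing so. *)
Lemma dpoly_vanish_eq f g v : tangent1 v -> (forall x, mem x -> f.@[x 0] = g.@[x 0]) ->
  dpoly f e v = dpoly g e v.
Proof.
move=> tv fg; apply/eqP; rewrite -subr_eq0 -dpolyB; apply/eqP/tv => x hx.
by rewrite mevalB fg // subrr.
Qed.

Lemma pm_diff_eq p (A B : polymap k m p) v : tangent1 v ->
  (forall x, mem x -> pm_eval A x = pm_eval B x) -> pm_diff A e v = pm_diff B e v.
Proof.
move=> tv AB; apply/rowP => i; rewrite !pm_diffE; apply: dpoly_vanish_eq => // x hx.
by rewrite -!pm_evalE AB.
Qed.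

Lemma tangent1_image (A : polymap k m m) v : tangent1 v ->
  (forall x, mem x -> mem (pm_eval A x)) -> pm_eval A e = e -> tangent1 (pm_diff A e v).
Proof.
move=> tv memA Ae f fI; rewrite -{1}Ae -dpoly_comp; apply: tv => x hx.
by rewrite meval_comp; apply/fI/memA.
Qed.

Definition lmul_map g : polymap k m m := pm_comp mul (pm_pair (pm_const m g) (pm_id k m)).

Lemma lmul_mapE g x : pm_eval (lmul_map g) x = g ** x.
Proof. by rewrite pm_eval_comp pm_eval_pair pm_eval_const pm_eval_id. Qed.

Lemma conj_mapE g x : pm_eval (conj_map g) x = (g ** x) ** (iv g).
Proof. by rewrite /conj_map pm_eval_comp pm_eval_pair lmul_mapE pm_eval_const. Qed.

Lemma conj_map1 g : mem g -> pm_eval (conj_map g) e = e.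
Proof. by move=> hg; rewrite conj_mapE ag_mulg1 // ag_mulgV. Qed.

Lemma Adjoint_tangent g v : mem g -> tangent1 v -> tangent1 (Adjoint g v).
Proof.
move=> hg tv; apply: tangent1_image => //; last exact: conj_map1.
move=> x hx; rewrite conj_mapE; apply: ag_memM; last exact: ag_memV.
exact: ag_memM.
Qed.

Lemma AdjointM g h v : mem g -> mem h -> tangent1 v ->
  Adjoint (g ** h) v = Adjoint g (Adjoint h v).
Proof.
move=> hg hh tv; have hg' := ag_memV hg; have hh' := ag_memV hh.
have hgh := ag_memM hg hh.
rewrite /Adjoint -{2}(conj_map1 hh) -pm_diff_comp; apply: pm_diff_eq => // x hx.
rewrite pm_eval_comp !conj_mapE ag_invM //.
have hhx := ag_memM hh hx.
rewrite -(ag_mulA hg hh hx) (ag_mulA hg hhx hh') -(ag_mulA _ hh' hg') //.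
exact: ag_memM.
Qed.

Lemma Adjoint1 v : tangent1 v -> Adjoint e v = v.
Proof.
move=> tv; rewrite /Adjoint -[RHS](pm_diff_id e); apply: pm_diff_eq => // x hx.
by rewrite conj_mapE pm_eval_id ag_mul1 // ag_inv1 ag_mulg1.
Qed.

Lemma Adjoint_linear (g : 'rV[k]_m) c v w :
  Adjoint (G := G) g (c *: v + w) = c *: Adjoint (G := G) g v + Adjoint (G := G) g w.
Proof. exact: pm_diff_linear. Qed.

Definition Lder v (f : {mpoly k[m]}) := \sum_i f^`M(i) * tnth (linv_field v) i.

Lemma meval_Lder v f (x : 'rV[k]_m) : (Lder v f).@[x 0] = dpoly f x (pm_eval (linv_field v) x).
Proof.
rewrite /Lder (raddf_sum (meval _)); apply: eq_bigr => i _.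
by rewrite /= mevalM pm_evalE.
Qed.

Lemma linv_fieldE (v x : 'rV[k]_m) : pm_eval (linv_field v) x =
  pm_diff mul (row_mx x e) (row_mx 0 v).
Proof.
apply/rowP => i; rewrite pm_evalE pm_diffE tnth_mktuple dpoly_row_mx [X in X + _]big1 ?add0r.
  rewrite (raddf_sum (meval _)); apply: eq_bigr => j _ /=.
  by rewrite mevalZ meval_comp pm_eval_pair pm_eval_id pm_eval_const mulrC.
by move=> j _; rewrite mxE mulr0.
Qed.

Lemma linv_field_lmul (v x : 'rV[k]_m) : pm_eval (linv_field v) x = pm_diff (lmul_map x) e v.
Proof.
rewrite linv_fieldE pm_diff_comp pm_eval_pair pm_eval_const pm_eval_id.
by rewrite pm_diff_pair pm_diff_const pm_diff_id.
Qed.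

Lemma linv_field1 v : tangent1 v -> pm_eval (linv_field v) e = v.
Proof.
move=> tv; rewrite linv_field_lmul -[RHS](pm_diff_id e); apply: pm_diff_eq => // x hx.
by rewrite lmul_mapE pm_eval_id ag_mul1.
Qed.

(** If f vanishes on G, so does its left translate by x in G, whose derivative at the identity along
    v is the value of [Lder v f] at x. *)
Lemma Lder_vanish v f : tangent1 v -> vanish f -> vanish (Lder v f).
Proof.
move=> tv fI x hx; rewrite meval_Lder linv_field_lmul -{1}(ag_mulg1 hx) -lmul_mapE -dpoly_comp.
by apply: tv => y hy; rewrite meval_comp lmul_mapE; apply/fI/ag_memM.
Qed.

Lemma meval_Lder1 v f : tangent1 v -> (Lder v f).@[e 0] = dpoly f e v.
Proof. by move=> tv; rewrite meval_Lder linv_field1. Qed.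

Lemma LderM v f g : Lder v (f * g) = f * Lder v g + Lder v f * g.
Proof.
rewrite /Lder mulr_sumr mulr_suml -big_split; apply: eq_bigr => i _ /=.
by rewrite mderivM; ring.
Qed.

Lemma Lder_comp v p (Q : {mpoly k[p]}) (A : polymap k m p) :
  Lder v (Q \mPo A) = \sum_j (Q^`M(j) \mPo A) * Lder v (tnth A j).
Proof.
rewrite /Lder; under eq_bigr => i _ do rewrite mderiv_comp mulr_suml.
rewrite exchange_big; apply: eq_bigr => j _ /=; rewrite mulr_sumr.
by apply: eq_bigr => i _; rewrite mulrA.
Qed.

Definition rmul1_map : polymap k m m := pm_comp mul (pm_pair (pm_id k m) (pm_const m e)).

(** Differentiate inv(x) x = e at the identity. The left argument contributes u itself by the right
    unit law, which may be used because u is tangent too. *)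
Lemma dinv_tangent v : tangent1 v -> pm_diff inv e v = - v.
Proof.
move=> tv; set u := pm_diff inv e v.
have tu : tangent1 u.
  by apply: tangent1_image => //; [move=> x; apply: ag_memV|apply: ag_inv1].
have := @pm_diff_eq _ (pm_comp mul (pm_pair inv (pm_id k m))) (pm_const m e) v tv.
rewrite pm_diff_const => h; apply/eqP; rewrite -subr_eq0 opprK -h; last first.
  by move=> x hx; rewrite pm_eval_comp pm_eval_pair pm_eval_id pm_eval_const ag_mulV.
rewrite pm_diff_comp pm_eval_pair pm_diff_pair pm_eval_id pm_diff_id ag_inv1 -/u.
have -> : row_mx u v = 1 *: row_mx u 0 + row_mx 0 v.
  by rewrite scale1r add_row_mx addr0 add0r.
rewrite pm_diff_linear scale1r -linv_fieldE linv_field1 //.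
suff -> : pm_diff mul (row_mx e e) (row_mx u 0) = u by [].
rewrite -[RHS](pm_diff_id e) -(@pm_diff_eq _ rmul1_map (pm_id k m)) //.
  rewrite pm_diff_comp pm_eval_pair pm_diff_pair pm_eval_id pm_eval_const.
  by rewrite pm_diff_id pm_diff_const.
by move=> x hx; rewrite pm_eval_comp pm_eval_pair !pm_eval_id pm_eval_const ag_mulg1.
Qed.

(** The chain rule for x -> (g x) g^-1 at the identity, with g kept as a variable: this makes Ad
    polynomial in g, hence differentiable. *)
Definition Ad_map v : polymap k m m :=
  [tuple \sum_a ((tnth mul i)^`M(lshift m a) \mPo pm_pair (pm_id k m) inv) *
                tnth (linv_field v) a | i < m].

Lemma Ad_mapE v g : mem g -> pm_eval (Ad_map v) g = Adjoint g v.
Proof.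
move=> hg; apply/rowP => i; rewrite pm_evalE tnth_mktuple /Adjoint /conj_map -/(lmul_map g).
rewrite pm_diff_comp pm_eval_pair pm_diff_pair lmul_mapE pm_eval_const ag_mulg1 //.
rewrite pm_diff_const -linv_field_lmul pm_diffE dpoly_row_mx [X in _ + X]big1 ?addr0.
  rewrite (raddf_sum (meval _)); apply: eq_bigr => a _ /=.
  by rewrite mevalM meval_comp pm_eval_pair pm_eval_id pm_evalE.
by move=> a _; rewrite mxE mulr0.
Qed.

(* The second-order terms of the multiplication are eliminated by applying
   the left-invariant fields of [v] and [w] to [g |-> g e - g], which vanishes
   on the group but not on the ambient space. *)
Lemma dAd_map v w : tangent1 v -> tangent1 w ->
  pm_diff (Ad_map w) e v = lie_bracket v w.
Proof.
move=> tv tw; apply/rowP => i; rewrite pm_diffE tnth_mktuple dpoly_sum.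
pose mi := tnth mul i; pose B x y a := dpoly (tnth (linv_field y) a) e x.
have first a : dpoly (mi^`M(lshift m a) \mPo pm_pair (pm_id k m) inv) e v =
   \sum_b mi^`M(lshift m a)^`M(lshift m b).@[row_mx e e 0] * v 0 b -
   \sum_b mi^`M(lshift m a)^`M(rshift m b).@[row_mx e e 0] * v 0 b.
  rewrite dpoly_comp pm_eval_pair pm_diff_pair pm_eval_id pm_diff_id ag_inv1 dinv_tangent //.
  rewrite dpoly_row_mx; congr (_ + _); rewrite -sumrN; apply: eq_bigr => b _.
  by rewrite mxE mulrN.
have Bwv : B w v i = \sum_a (\sum_b mi^`M(lshift m a)^`M(rshift m b).@[row_mx e e 0] * v 0 b) * w 0 a.
  rewrite /B tnth_mktuple dpoly_sum.
  under eq_bigr => j _ do rewrite dpolyZ dpoly_comp pm_eval_pair pm_diff_pair pm_eval_id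
    pm_eval_const pm_diff_id pm_diff_const dpoly_row_mx.
  rewrite [RHS](eq_bigr (fun a => \sum_b v 0 b * (mi^`M(lshift m a)^`M(rshift m b).@[row_mx e e 0] * w 0 a))).
    rewrite exchange_big /=; apply: eq_bigr => b _.
    rewrite [X in _ + X]big1 ?addr0 => [|a _]; last by rewrite mxE mulr0.
    by rewrite mulr_sumr; apply: eq_bigr => a _; rewrite mderiv_comm.
  by move=> a _; rewrite mulr_suml; apply: eq_bigr => b _; ring.
pose r i : {mpoly k[m]} := tnth rmul1_map i - 'X_i.
have rI : vanish (r i).
  move=> x hx; rewrite mevalB mevalXU -pm_evalE pm_eval_comp pm_eval_pair pm_eval_id.
  by rewrite pm_eval_const ag_mulg1 // subrr.
have dr a : (r i)^`M(a) = (mi^`M(lshift m a) \mPo pm_pair (pm_id k m) (pm_const m e)) - (i == a)%:R.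
  rewrite mderivB mderivXU; congr (_ - _).
  rewrite tnth_mktuple mderiv_comp big_split_ord /= [X in _ + X]big1 ?addr0.
    rewrite (bigD1 a) //= tnth_pairl tnth_mktuple mderivXU eqxx mulr1.
    rewrite big1 ?addr0 // => b ba.
    by rewrite tnth_pairl tnth_mktuple mderivXU (negbTE ba) mulr0.
  by move=> b _; rewrite tnth_pairr tnth_mktuple mderivC mulr0.
pose C a := \sum_b mi^`M(lshift m a)^`M(lshift m b).@[row_mx e e 0] * v 0 b.
have term a : dpoly ((r i)^`M(a) * tnth (linv_field w) a) e v =
    mi^`M(lshift m a).@[row_mx e e 0] * B v w a - (i == a)%:R * B v w a + C a * w 0 a.
  rewrite dpolyM -pm_evalE linv_field1 // dr mevalB dpolyB -mpolyC_nat dpolyC mevalC subr0.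
  rewrite meval_comp pm_eval_pair pm_eval_id pm_eval_const mulrBl; congr (_ + _ * _).
  rewrite dpoly_comp pm_eval_pair pm_diff_pair pm_eval_id pm_eval_const pm_diff_id pm_diff_const.
  by rewrite dpoly_row_mx [X in _ + X]big1 ?addr0 // => b _; rewrite mxE mulr0.
(* This is the vanishing at the identity of L_v L_w applied to x e - x; it expresses the pure second
   derivatives of the multiplication through first derivatives of the invariant fields. *)
have key : \sum_a mi^`M(lshift m a).@[row_mx e e 0] * B v w a + \sum_a C a * w 0 a = B v w i.
  have := Lder_vanish tv (Lder_vanish tw rI) (ag_mem1 G).
  rewrite meval_Lder1 // /Lder dpoly_sum (eq_bigr _ (fun a _ => term a)) !big_split /= sumrN.
  rewrite [X in _ - X](bigD1 i) //= eqxx mul1r [X in _ - (_ + X)]big1 ?addr0; last first.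
    by move=> a ai; rewrite eq_sym (negbTE ai) mul0r.
  by move=> /eqP; rewrite addrAC subr_eq0 => /eqP.
have -> : lie_bracket v w 0 i = B v w i - B w v i by rewrite !mxE.
rewrite Bwv -key -addrA -sumrB -big_split; apply: eq_bigr => a _ /=.
rewrite dpolyM first -pm_evalE linv_field1 // meval_comp pm_eval_pair pm_eval_id ag_inv1.
by rewrite -mulrBl.
Qed.

End Group.

(** * The coadjoint action *)

Section Coadjoint.
Variables (k : fieldType) (G : affAlgGroup k) (n : nat) (b : 'M[k]_(n, ag_amb G)).
Hypothesis hb : lie_basis b.
Local Notation m := (ag_amb G).
Local Notation e := (ag_one G).
Local Notation mem := (@ag_mem k G).
Local Notation mul := (ag_mul G).
Local Notation iv g := (pm_eval (ag_inv G) g).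
Local Notation "g ** h" := (pm_eval mul (row_mx g h)) (at level 40, left associativity).
Local Notation dlt j := (delta_mx 0 j : 'rV[k]_n).

Lemma basis_tangent (x : 'rV[k]_n) : tangent1 (x *m b).
Proof. by apply/hb.2; apply: submxMl. Qed.

Lemma coordsK (v : 'rV[k]_m) : tangent1 v -> coords b v *m b = v.
Proof. by move=> /hb.2 tv; rewrite mulmxKpV. Qed.

Lemma basis_coords (x : 'rV[k]_n) : coords b (x *m b) = x.
Proof. by rewrite /coords mulmxKp //; case: hb. Qed.

Lemma coords_linear c (v w : 'rV[k]_m) : coords b (c *: v + w) = c *: coords b v + coords b w.
Proof. by rewrite /coords mulmxDl scalemxAl. Qed.

Lemma Ad_linear g c x y : Ad b g (c *: x + y) = c *: Ad b g x + Ad b g y.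
Proof. by rewrite /Ad mulmxDl -scalemxAl Adjoint_linear coords_linear. Qed.

Lemma Ad_sum g I (r : seq I) (c : I -> k) (x : I -> 'rV[k]_n) :
  Ad b g (\sum_(i <- r) c i *: x i) = \sum_(i <- r) c i *: Ad b g (x i).
Proof.
elim: r => [|i r IHr]; last by rewrite !big_cons Ad_linear IHr.
by rewrite !big_nil; have := Ad_linear g (-1) 0 0; rewrite scaler0 addr0 scaleN1r addNr.
Qed.

Lemma AdM g h x : mem g -> mem h -> Ad b (g ** h) x = Ad b g (Ad b h x).
Proof.
move=> hg hh; rewrite /Ad coordsK; last by apply: Adjoint_tangent => //; apply: basis_tangent.
by rewrite AdjointM //; apply: basis_tangent.
Qed.

Lemma Ad1 x : Ad b e x = x.
Proof. by rewrite /Ad Adjoint1 ?basis_coords //; apply: basis_tangent. Qed.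

Lemma br_antisym x y : br b x y = - br b y x.
Proof. by rewrite /br /lie_bracket -opprB /coords mulNmx. Qed.

Lemma linv_field_linear c (v w : 'rV[k]_m) i : tnth (linv_field (G := G) (c *: v + w)) i =
  c *: tnth (linv_field v) i + tnth (linv_field w) i.
Proof.
rewrite !tnth_mktuple scaler_sumr -big_split; apply: eq_bigr => j _ /=.
by rewrite !mxE scalerA scalerDl.
Qed.

Lemma br_linear c x x' y : br b (c *: x + x') y = c *: br b x y + br b x' y.
Proof.
rewrite /br -coords_linear; congr (coords b _); rewrite mulmxDl -scalemxAl.
apply/rowP => i; rewrite !mxE dpoly_is_linear linv_field_linear dpolyD dpolyZ.
by ring.
Qed.

Lemma row_lin c (u v : 'rV[k]_n) j : (c *: u + v) 0 j = c * u 0 j + v 0 j.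
Proof. by rewrite !mxE. Qed.

Lemma coadE x xi j : coad b x xi 0 j = - pairing xi (br b x (dlt j)).
Proof. by rewrite /coad mxE. Qed.

Lemma coad_linear c x y xi : coad b (c *: x + y) xi = c *: coad b x xi + coad b y xi.
Proof.
apply/rowP => j.
rewrite [RHS]row_lin.
apply: etrans (coadE _ _ _) _; apply/esym.
apply: etrans (congr2 +%R (congr1 (GRing.mul c) (coadE x xi j)) (coadE y xi j)) _.
rewrite br_linear.
rewrite /pairing mulrN -opprD mulr_sumr -big_split /=.
congr (- _); apply: eq_bigr => i _.
move: (br b x _) (br b y _) => u v; rewrite !mxE; ring.
Qed.

Definition Ad_pol i j : {mpoly k[m]} :=
  \sum_a (pinvmx b a i) *: tnth (Ad_map (dlt j *m b)) a.

Lemma Ad_polE i j g : mem g -> (Ad_pol i j).@[g 0] = Ad b g (dlt j) 0 i.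
Proof.
move=> hg; rewrite (raddf_sum (meval _)) mxE; apply: eq_bigr => a _ /=.
by rewrite mevalZ -pm_evalE Ad_mapE // mulrC.
Qed.

Lemma dAd_pol i j x : dpoly (Ad_pol i j) e (x *m b) = br b x (dlt j) 0 i.
Proof.
rewrite dpoly_sum mxE; apply: eq_bigr => a _ /=.
rewrite dpolyZ -pm_diffE dAd_map; [by rewrite mulrC|exact: basis_tangent|exact: basis_tangent].
Qed.

(* The orbit map of [xi], reparametrised by inversion. *)
Definition rho (xi : 'rV[k]_n) : polymap k m n :=
  [tuple \sum_i xi 0 i *: Ad_pol i j | j < n].

Lemma rhoE xi g j : mem g -> pm_eval (rho xi) g 0 j = pairing xi (Ad b g (dlt j)).
Proof.
move=> hg; rewrite pm_evalE tnth_mktuple (raddf_sum (meval _)); apply: eq_bigr => i _ /=.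
by rewrite mevalZ Ad_polE.
Qed.

Lemma rho1 xi : pm_eval (rho xi) e = xi.
Proof.
apply/rowP => j; rewrite rhoE ?Ad1 /pairing; last exact: ag_mem1.
rewrite (bigD1 j) //= mxE !eqxx mulr1 big1 ?addr0 // => i ij.
by rewrite mxE (negbTE ij) andbF mulr0.
Qed.

Lemma drho xi x : pm_diff (rho xi) e (x *m b) = - coad b x xi.
Proof.
apply/rowP => j; rewrite pm_diffE tnth_mktuple dpoly_sum !mxE opprK.
by apply: eq_bigr => i _; rewrite dpolyZ dAd_pol.
Qed.

Lemma coAd_rho g xi : mem g -> coAd b g xi = pm_eval (rho xi) (iv g).
Proof. by move=> hg; apply/rowP => j; rewrite rhoE ?mxE //; apply: ag_memV. Qed.

Lemma orbit_rho xi eta : orbit_of b xi eta <-> exists2 g, mem g & eta = pm_eval (rho xi) g.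
Proof.
split=> -[g hg ->]; exists (iv g); rewrite ?coAd_rho ?ag_invK //; exact: ag_memV.
Qed.

Lemma rhoM xi g h j : mem g -> mem h -> pm_eval (rho xi) (g ** h) 0 j =
  \sum_i (Ad_pol i j).@[h 0] * pm_eval (rho xi) g 0 i.
Proof.
move=> hg hh; rewrite rhoE; last exact: ag_memM.
rewrite AdM // [Ad b h _]row_sum_delta Ad_sum /pairing.
under eq_bigr => a _ do rewrite summxE mulr_sumr.
rewrite exchange_big; apply: eq_bigr => i _ /=.
rewrite Ad_polE // rhoE // /pairing mulr_sumr; apply: eq_bigr => a _.
by rewrite !mxE; ring.
Qed.

(** f is constant along the orbit map; differentiate at the identity. *)
Lemma invariant_coad f x xi : invariant b f -> dpoly f xi (coad b x xi) = 0.
Proof.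
move=> finv.
have := @basis_tangent x (f \mPo rho xi - (f.@[xi 0])%:MP).
rewrite dpolyB dpolyC subr0 dpoly_comp rho1 drho => h.
have := dpoly_is_linear f xi (-1) (coad b x xi) 0.
rewrite addr0 scaleN1r h => [/eqP|g hg].
  have -> : dpoly f xi 0 = 0 by rewrite /dpoly big1 // => i _; rewrite mxE mulr0.
  by rewrite addr0 mulN1r eq_sym oppr_eq0 => /eqP.
rewrite mevalB mevalC meval_comp; have := finv _ xi (ag_memV hg).
by rewrite coAd_rho ?ag_invK // => [->|]; [rewrite subrr|apply: ag_memV].
Qed.

Definition Lie_mx (xi : 'rV[k]_n) : 'M[k]_n := \matrix_(j, i) coad b (dlt i) xi 0 j.

Lemma coad_sum xi I (r : seq I) (c : I -> k) (x : I -> 'rV[k]_n) :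
  coad b (\sum_(i <- r) c i *: x i) xi = \sum_(i <- r) c i *: coad b (x i) xi.
Proof.
elim: r => [|i r IHr]; last by rewrite !big_cons coad_linear IHr.
by rewrite !big_nil; have := coad_linear (-1) 0 0 xi; rewrite scaler0 addr0 scaleN1r addNr.
Qed.

Lemma Lie_mxE xi x : coad b x xi = (Lie_mx xi *m x^T)^T.
Proof.
apply/rowP => j; rewrite {1}[x]row_sum_delta coad_sum summxE [RHS]mxE [RHS]mxE.
apply: eq_bigr => i _; rewrite [LHS]mxE [Lie_mx _ _ _]mxE [x^T i 0]mxE; exact: mulrC.
Qed.

Lemma Lie_mx_rank xi : (\rank (Lie_mx xi) + stab_dim b xi = n)%N.
Proof.
rewrite /stab_dim mxrank_ker.
have -> : lin1_mx (coad b ^~ xi) = (Lie_mx xi)^T.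
  by apply/matrixP => i j; rewrite !mxE.
by rewrite mxrank_tr subnKC // rank_leq_row.
Qed.

End Coadjoint.

(** * Dimension of coadjoint orbits *)

Section IteratedDerivatives.
Variables (k : fieldType) (char0 : [pchar k] =i pred0) (r : nat).

Definition mderivs (s : seq 'I_r) (Q : {mpoly k[r]}) := foldl (fun q j => q^`M(j)) Q s.

Lemma meval0_mcoeff (Q : {mpoly k[r]}) : Q.@[fun=> 0] = Q@_0.
Proof.
move: Q; apply: (@mpoly_rmorph_ext _ _ _ (meval (fun=> 0)) (mcoeff 0)) => [c|i] /=.
  by rewrite mevalC mcoeffC eqxx mulr1.
by rewrite mevalXU mcoeffX mnm1_eq0.
Qed.

(** Taylor's formula at 0: each coefficient is, up to a nonzero integer, an iterated derivative at
    0. *)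
Lemma mderivs_eq0 (Q : {mpoly k[r]}) : (forall s, (mderivs s Q).@[fun=> 0] = 0) -> Q = 0.
Proof.
move=> hQ; apply/mpolyP => M; rewrite mcoeff0.
have [d] := ubnP (mdeg M); elim: d M Q hQ => // d IHd M Q hQ hM.
have [->|/eqP M0] := eqVneq M 0%MM; first by rewrite -meval0_mcoeff (hQ [::]).
have [j Mj] : exists j, M j != 0%N.
  apply: boolp.contrapT => no; apply: M0; apply/mnmP => j; rewrite mnm0E.
  by apply/eqP/negPn/negP => Mj; apply: no; exists j.
have /eqP : Q@_M *+ ((M - U_(j))%MM j).+1 = 0.
  rewrite -{1}(@submK _ U_(j)%MM M) ?lep1mP // -mcoeff_mderiv.
  apply: IHd => [s|]; first exact: (hQ (j :: s)).
  rewrite -ltnS (leq_trans _ hM) // ltnS -{2}(@submK _ U_(j)%MM M) ?lep1mP //.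
  by rewrite mdegD mdeg1 addn1.
by rewrite -mulr_natr mulf_eq0 (negbTE (natr_neq0 char0 _)) orbF => /eqP.
Qed.

Variables (G : affAlgGroup k) (phi : polymap k (ag_amb G) r) (v : 'I_r -> 'rV[k]_(ag_amb G)).
Local Notation m := (ag_amb G).
Local Notation e := (ag_one G).
Hypotheses (tv : forall a, tangent1 (v a)) (phi1 : pm_eval phi e = 0).
Hypothesis dphi : forall i a, dpoly (tnth phi i) e (v a) = (i == a)%:R.

Definition Lders (s : seq 'I_r) (f : {mpoly k[m]}) := foldl (fun f j => Lder (v j) f) f s.

Lemma LderD u (f g : {mpoly k[m]}) : Lder u (f + g) = Lder u f + Lder u g.
Proof.
by rewrite /Lder -big_split; apply: eq_bigr => i _; rewrite mderivD mulrDl.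
Qed.

Lemma LdersD s (f g : {mpoly k[m]}) : Lders s (f + g) = Lders s f + Lders s g.
Proof. by elim: s f g => //= j s IHs f g; rewrite LderD IHs. Qed.

Lemma Lder0 u : Lder u (0 : {mpoly k[m]}) = 0.
Proof. by rewrite /Lder big1 // => i _; rewrite mderiv0 mul0r. Qed.

Lemma Lders_sum s I (t : seq I) (F : I -> {mpoly k[m]}) :
  Lders s (\sum_(i <- t) F i) = \sum_(i <- t) Lders s (F i).
Proof.
elim: t => [|i t IHt]; last by rewrite !big_cons LdersD IHt.
by rewrite !big_nil; elim: s => //= j s IHs; rewrite Lder0.
Qed.

Lemma Lders_vanish s f : vanish f -> vanish (Lders s f).
Proof. by elim: s f => //= j s IHs f fI; apply/IHs/Lder_vanish. Qed.

(* Only the terms in which each derivation hits a different factor [phi i]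
   survive at the identity, because [phi] vanishes there. *)
Lemma Lders_comp s (Q : {mpoly k[r]}) (a : {mpoly k[m]}) :
  (forall t, (size t < size s)%N -> (mderivs t Q).@[fun=> 0] = 0) ->
  (Lders s ((Q \mPo phi) * a)).@[e 0] = a.@[e 0] * (mderivs s Q).@[fun=> 0].
Proof.
elim: s Q a => [|j s IHs] Q a hQ /=.
  rewrite mevalM meval_comp phi1 mulrC; congr (_ * _).
  by apply: meval_eq => i; rewrite mxE.
rewrite LderM LdersD mevalD IHs; last first.
  by move=> t ht; apply: hQ; rewrite ltnW.
rewrite hQ ?mulr0 ?add0r // Lder_comp mulr_suml Lders_sum (raddf_sum (meval _)) /=.
under eq_bigr => i _.
  rewrite -mulrA IHs; last by move=> t ht; apply: (hQ (i :: t)).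
  rewrite mevalM meval_Lder1 // dphi; over.
rewrite (bigD1 j) //= eqxx mul1r big1 ?addr0 // => i ij.
by rewrite (negbTE ij) !mul0r.
Qed.

(** Once the derivatives of Q at 0 of lower order vanish, [Lders_comp] identifies the next one with
    an iterated invariant derivative of Q o phi at the identity, which is zero since these
    derivatives preserve vanishing on G. *)
Lemma comp_submersion_indep (Q : {mpoly k[r]}) : vanish (Q \mPo phi) -> Q = 0.
Proof.
move=> QI; apply: mderivs_eq0 => s.
have [d] := ubnP (size s); elim: d s => // d IHd s sd.
have low t : (size t < size s)%N -> (mderivs t Q).@[fun=> 0] = 0.
  by move=> ts; apply: IHd; apply: leq_trans ts _; rewrite -ltnS.
have := @Lders_comp s Q 1 low; rewrite mulr1 meval1 mul1r => <-.
by apply: (Lders_vanish _ QI); apply: ag_mem1.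
Qed.

End IteratedDerivatives.

Section OrbitLower.
Variables (k : fieldType) (char0 : [pchar k] =i pred0).
Variables (G : affAlgGroup k) (n : nat) (b : 'M[k]_(n, ag_amb G)).
Hypothesis hb : lie_basis b.

Lemma orbit_dim_ge xi : dim_ge (orbit_of b xi) (\rank (Lie_mx b xi)).
Proof.
set r := \rank _; pose L := Lie_mx b xi.
pose C : 'M_(r, n) := pinvmx (col_base L); pose Z : 'M_(n, r) := pinvmx (row_base L).
have CLZ : C *m L *m Z = 1%:M.
  rewrite -[L in C *m L]mulmx_base mulmxA /C mulVpmx ?col_base_full // mul1mx.
  by rewrite /Z mulmxVp // row_base_free.
pose f : r.-tuple {mpoly k[n]} := [tuple \sum_j C i j *: ('X_j - (xi 0 j)%:MP) | i < r].
have dfE i a w : dpoly (tnth f i) a w = \sum_j C i j * w 0 j.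
  rewrite tnth_mktuple dpoly_sum; apply: eq_bigr => j _.
  by rewrite dpolyZ dpolyB dpolyXU dpolyC subr0.
exists f => P hP.
(* The sign compensates that of [drho]: with C L Z = 1 the differential of f o rho in these
   directions is the identity. *)
pose v a := - (col a Z)^T *m b.
apply: (@comp_submersion_indep _ char0 _ G (pm_comp f (rho b xi)) v).
- by move=> a; apply: basis_tangent.
- apply/rowP => i; rewrite pm_eval_comp (rho1 hb) pm_evalE tnth_mktuple (raddf_sum (meval _)).
  by rewrite mxE big1 // => j _ /=; rewrite mevalZ mevalB mevalXU mevalC subrr mulr0.
- move=> i a; rewrite tnth_mktuple dpoly_comp (rho1 hb) (drho hb) dfE.
  have := congr1 (fun M : 'M_r => M i a) CLZ; rewrite [RHS]mxE => <-.
  rewrite -mulmxA mxE; apply: eq_bigr => j _; congr (_ * _).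
  have -> : - coad b (- (col a Z)^T) xi = (L *m col a Z)^T.
    by rewrite Lie_mxE // linearN /= trmxK mulmxN linearN opprK.
  rewrite [LHS]mxE [LHS]mxE [RHS]mxE; apply: eq_bigr => z _; congr (_ * _).
  by rewrite mxE.
move=> g hg; rewrite (_ : P \mPo _ = (P \mPo f) \mPo rho b xi).
  rewrite meval_comp; apply: hP; apply/orbit_rho; by exists g.
  move: P {hP}; apply: (@mpoly_rmorph_ext _ _ _ (comp_mpoly (pm_comp f (rho b xi)))
    (comp_mpoly (rho b xi) \o comp_mpoly f)) => [c|i] /=.
  by rewrite !comp_mpolyC.
by rewrite !comp_mpolyXU -!tnth_nth tnth_mktuple.
Qed.

End OrbitLower.

Lemma spanning_rows (k : fieldType) N (V : 'rV[k]_N -> Prop) :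
  exists r (U : 'M[k]_(r, N)), (forall i, V (row i U)) /\ forall v, V v -> (v <= U)%MS.
Proof.
have [|d [[r [U [UV dU]]] dmin]] := @nat_least (fun d => exists r (U : 'M[k]_(r, N)),
    (forall i, V (row i U)) /\ d = (N - \rank U)%N).
  by exists (N - \rank (0%R : 'M[k]_(0, N)))%N, 0%N, 0; split=> // -[].
exists r, U; split=> // v Vv; apply: boolp.contrapT => vU.
pose U' := col_mx U v.
have : (d <= N - \rank U')%N.
  apply: dmin; exists (r + 1)%N, U'; split=> // i; rewrite /U'.
  case: (splitP i) => j ij.
    by rewrite (_ : i = lshift 1 j) ?rowKu //; apply: val_inj.
  by rewrite (_ : i = rshift r j) ?rowKd ?row_id //; apply: val_inj.
have UU' : (U <= U')%MS by rewrite -addsmxE addsmxSl.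
have [rle req] := mxrank_leqif_sup UU'.
have : ~~ (\rank U == \rank U').
  rewrite req; apply/negP => U'U; apply: vU; apply: submx_trans U'U.
  by rewrite -addsmxE addsmxSr.
have := rank_leq_col U'; move: rle; rewrite dU; move: (\rank U) (\rank U') => a c.
by lia.
Qed.

Section FieldPoints.
Variables (k L : fieldType) (iota : {rmorphism k -> L}) (m : nat).
Variables (V : 'rV[k]_m -> Prop) (x : 'I_m -> L).
Hypothesis Vx : forall h, vanishes_on V h -> mmap iota x h = 0.

(* The values at [x] of the monomials of [T] are a combination over the large
   field of their values at finitely many points of [V]. *)
Lemma vanish_field_point (T : {mpoly L[m]}) :
  (forall g, V g -> T.@[fun i => iota (g 0 i)] = 0) -> T.@[x] = 0.
Proof.
move=> TV; pose N := size (msupp T); pose be (i : 'I_N) := nth 0%MM (msupp T) i.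
have evT y : T.@[y] = ((\row_i 'X_[be i].@[y]) *m (\col_i T@_(be i))) 0 0.
  rewrite mevalE mxE (big_nth 0%MM) big_mkord; apply: eq_bigr => i _.
  by rewrite !mxE mevalX mulrC.
pose ro (g : 'rV[k]_m) : 'rV[k]_N := \row_i 'X_[be i].@[g 0].
have [r [U [UV VU]]] := spanning_rows (fun v => exists2 g, V g & v = ro g).
have rowU i : (map_mx iota (row i U) *m (\col_i T@_(be i))) 0 0 = 0.
  have [g Vg ->] := UV i; rewrite -(TV g Vg) evT; congr ((_ *m _) 0 0).
  apply/rowP => j; rewrite !mxE !mevalX rmorph_prod; apply: eq_bigr => z _.
  by rewrite rmorphXn.
have phiU : ((\row_i 'X_[be i].@[x]) <= map_mx iota U)%MS.
  rewrite submxE -map_cokermx; apply/eqP/rowP => j; rewrite [RHS]mxE.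
  pose h : {mpoly k[m]} := \sum_i cokermx U i j *: 'X_[be i].
  have /Vx : vanishes_on V h.
    move=> g Vg; have : (ro g <= U)%MS by apply: VU; exists g.
    rewrite submxE => /eqP/rowP/(_ j); rewrite [RHS]mxE => <-.
    rewrite mxE (raddf_sum (meval _)); apply: eq_bigr => i _ /=.
    by rewrite mevalZ [ro g 0 i]mxE mulrC.
  rewrite /h (raddf_sum (mmap _ _)) => <-; rewrite mxE; apply: eq_bigr => i _ /=.
  by rewrite mmapZ mmapX !mxE mevalX mulrC.
rewrite evT; have /submxP[la ->] := phiU; rewrite -mulmxA mxE big1 // => i _.
rewrite [X in _ * X](_ : _ = 0) ?mulr0 // -(rowU i) map_row -row_mul [RHS]mxE //.
Qed.

End FieldPoints.

Section TwoVariables.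
Variables (k L : fieldType) (m : nat) (V : 'rV[k]_m -> Prop).
Variables (ev : {rmorphism {mpoly k[m]} -> L}) (w : 'I_m -> L).
Hypothesis evV : forall h, vanishes_on V h -> ev h = 0.
Hypothesis wV : forall h, vanishes_on V h -> \sum_j ev h^`M(j) * w j = 0.

Local Notation iota := (ev \o @mpolyC m k).
Local Notation diag := (pm_pair (pm_id k m) (pm_id k m)).

Lemma ev_mmap h : ev h = mmap iota (fun i => ev 'X_i) h.
Proof.
move: h; apply: (@mpoly_rmorph_ext _ _ _ ev (mmap iota (fun i => ev 'X_i))) => [c|i].
  by rewrite /= mmapC.
by rewrite /= mmapX mmap1U.
Qed.

Lemma mderiv_fix_right (E : {mpoly k[m + m]}) (g : 'rV[k]_m) j :
  (E \mPo pm_pair (pm_id k m) (pm_const m g))^`M(j) =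
  E^`M(lshift m j) \mPo pm_pair (pm_id k m) (pm_const m g).
Proof.
rewrite mderiv_comp big_split_ord /= [X in _ + X]big1 ?addr0.
  rewrite (bigD1 j) //= tnth_pairl tnth_mktuple mderivXU eqxx mulr1 big1 ?addr0 // => i ij.
  by rewrite tnth_pairl tnth_mktuple mderivXU (negbTE ij) mulr0.
by move=> i _; rewrite tnth_pairr tnth_mktuple mderivC mulr0.
Qed.

(** For fixed h in V, the polynomial E(., h) vanishes on V, so its derivative along w at the generic
    point is zero. This derivative is a polynomial T in h over [L] vanishing on V, hence also at the
    generic point by [vanish_field_point]; so both arguments may be generic. *)
Lemma partial_vanish (E : {mpoly k[m + m]}) :
  (forall g h, V g -> V h -> E.@[row_mx g h 0] = 0) ->
  \sum_j ev (E^`M(lshift m j) \mPo diag) * w j = 0.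
Proof.
move=> hE.
(* The left block is specialised to the generic point, the right block stays variable. *)
pose var (i : 'I_(m + m)) : {mpoly L[m]} :=
  match split i with inl j => (ev 'X_j)%:MP | inr j => 'X_j end.
pose psi := mmap (@mpolyC m L \o iota) var.
have varl j : var (lshift m j) = (ev 'X_j)%:MP by rewrite /var (unsplitK (inl _ j)).
have varr j : var (rshift m j) = 'X_j by rewrite /var (unsplitK (inr _ j)).
have psi_ev (A : polymap k m m) y Q : (forall j, y j = ev (tnth A j)) ->
    (psi Q).@[y] = ev (Q \mPo pm_pair (pm_id k m) A).
  move=> hy; move: Q; apply: (@mpoly_rmorph_ext _ _ _ (meval y \o psi)
    (ev \o comp_mpoly (pm_pair (pm_id k m) A))) => [c|i] /=.
    by rewrite /psi mmapC mevalC comp_mpolyC.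
  rewrite /psi mmapX mmap1U comp_mpolyXU -tnth_nth; case: (splitP i) => j ij.
    have -> : i = lshift m j by apply: val_inj.
    by rewrite varl mevalC tnth_pairl tnth_mktuple.
  have -> : i = rshift m j by apply: val_inj.
  by rewrite varr mevalXU tnth_pairr hy.
pose T := \sum_j psi E^`M(lshift m j) * (w j)%:MP.
have Tev (A : polymap k m m) y : (forall j, y j = ev (tnth A j)) ->
    T.@[y] = \sum_j ev (E^`M(lshift m j) \mPo pm_pair (pm_id k m) A) * w j.
  move=> hy; rewrite (raddf_sum (meval _)); apply: eq_bigr => j _ /=.
  by rewrite mevalM mevalC (psi_ev A).
rewrite -(Tev _ (fun i => ev 'X_i)) => [|j]; last by rewrite tnth_mktuple.
apply: (@vanish_field_point _ _ iota _ V) => [h hV|g Vg].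
  by rewrite -ev_mmap evV.
rewrite (Tev (pm_const m g)) => [|j]; last by rewrite tnth_mktuple.
under eq_bigr => j _ do rewrite -mderiv_fix_right.
apply: wV => x Vx; rewrite meval_comp pm_eval_pair pm_eval_id pm_eval_const; exact: hE.
Qed.

End TwoVariables.

Section OrbitUpper.
Variables (k : fieldType) (char0 : [pchar k] =i pred0).
Variables (G : affAlgGroup k) (n : nat) (b : 'M[k]_(n, ag_amb G)).
Hypothesis hb : lie_basis b.
Local Notation m := (ag_amb G).
Local Notation e := (ag_one G).
Local Notation mem := (@ag_mem k G).
Local Notation mul := (ag_mul G).
Local Notation inv := (ag_inv G).
Local Notation diag := (pm_pair (pm_id k m) (pm_id k m)).

(** The tangent space is cut out by finitely many linear equations over [k], the rows of U, so its
    points over [L] are spanned by the basis [b]. *)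
Lemma tangent_field_point (L : fieldType) (iota : {rmorphism k -> L}) (w : 'rV[L]_m) :
  (forall h : {mpoly k[m]}, vanishes_on mem h -> \sum_j iota h^`M(j).@[e 0] * w 0 j = 0) ->
  (w <= map_mx iota b)%MS.
Proof.
move=> hw; pose grad (h : {mpoly k[m]}) : 'rV[k]_m := \row_j h^`M(j).@[e 0].
have [r [U [UV VU]]] := spanning_rows (fun v => exists2 h, vanishes_on mem h & v = grad h).
have cU : ((cokermx b)^T <= U)%MS.
  rewrite submxE; apply/eqP/matrixP => j j'; rewrite [RHS]mxE.
  pose d := (col j' (cokermx U))^T.
  have /hb.2/submxP[y dy] : tangent1 d.
    move=> h hI; have : (grad h <= U)%MS by apply: VU; exists h.
    rewrite submxE => /eqP/rowP/(_ j'); rewrite [RHS]mxE => <-.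
    by rewrite mxE; apply: eq_bigr => i _; rewrite !mxE.
  have := congr1 (fun A => (A *m cokermx b) 0 j) dy.
  rewrite -mulmxA mulmx_coker mulmx0 [RHS]mxE => <-.
  by rewrite !mxE; apply: eq_bigr => i _; rewrite !mxE mulrC.
have wU : w *m (map_mx iota U)^T = 0.
  apply/rowP => i; rewrite [RHS]mxE; have [h hI rU] := UV i; rewrite -(hw h hI) mxE.
  apply: eq_bigr => j _; rewrite mulrC; congr (_ * _).
  by have /rowP/(_ j) := rU; rewrite !mxE => ->.
rewrite submxE -map_cokermx; apply/eqP.
have /submxP[la E] := cU.
by rewrite -[cokermx b]trmxK E -map_trmx map_mxM trmx_mul mulmxA wU mul0mx.
Qed.

Section AtGenericPoint.
Variables (L : fieldType) (ev : {rmorphism {mpoly k[m]} -> L}) (w : 'I_m -> L).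
Hypothesis evI : forall h, vanishes_on mem h -> ev h = 0.
Hypothesis wI : forall h, vanishes_on mem h -> \sum_j ev h^`M(j) * w j = 0.
Local Notation iota := (ev \o @mpolyC m k).

Lemma ev_eq f g : (forall x, mem x -> f.@[x 0] = g.@[x 0]) -> ev f = ev g.
Proof.
move=> fg; apply/eqP; rewrite -subr_eq0 -rmorphB; apply/eqP/evI => x hx.
by rewrite mevalB fg // subrr.
Qed.

Definition left_vars : polymap k (m + m) m := [tuple 'X_(lshift m i) | i < m].
Definition right_vars : polymap k (m + m) m := [tuple 'X_(rshift m i) | i < m].

Lemma tnth_left_vars i : tnth left_vars i = 'X_(lshift m i).
Proof. exact: tnth_mktuple. Qed.

Lemma tnth_right_vars i : tnth right_vars i = 'X_(rshift m i).
Proof. exact: tnth_mktuple. Qed.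

Lemma left_varsE g h : pm_eval left_vars (row_mx g h) = g.
Proof. by apply/rowP => i; rewrite mxE tnth_mktuple mevalXU row_mxEl. Qed.

Lemma right_varsE g h : pm_eval right_vars (row_mx g h) = h.
Proof. by apply/rowP => i; rewrite mxE tnth_mktuple mevalXU row_mxEr. Qed.

Definition quot_map : polymap k (m + m) m :=
  pm_comp mul (pm_pair left_vars (pm_comp inv right_vars)).

Lemma quot_mapE g h :
  pm_eval quot_map (row_mx g h) = pm_eval mul (row_mx g (pm_eval inv h)).
Proof. by rewrite pm_eval_comp pm_eval_pair pm_eval_comp left_varsE right_varsE. Qed.

Lemma quot_map_diag x : mem x -> pm_eval quot_map (pm_eval diag x) = e.
Proof. by move=> hx; rewrite pm_eval_pair pm_eval_id quot_mapE ag_mulgV. Qed.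

(* The tangent vector [w] at the generic point x, moved to the identity by
   right translation by x^-1. *)
Definition at_identity : 'rV[L]_m :=
  \row_a \sum_j ev ((tnth quot_map a)^`M(lshift m j) \mPo diag) * w j.

Lemma dquot_map (Q : {mpoly k[m]}) :
  \sum_j ev ((Q \mPo quot_map)^`M(lshift m j) \mPo diag) * w j =
  \sum_a iota Q^`M(a).@[e 0] * at_identity 0 a.
Proof.
under [RHS]eq_bigr => a _ do rewrite mxE mulr_sumr.
rewrite exchange_big; apply: eq_bigr => j _ /=.
rewrite mderiv_comp (raddf_sum (comp_mpoly diag)) (raddf_sum ev) /= mulr_suml.
apply: eq_bigr => a _; rewrite !rmorphM /= mulrA; congr (_ * _ * _).
by apply: ev_eq => x hx; rewrite meval_comp meval_comp quot_map_diag // mevalC.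
Qed.

Lemma at_identity_tangent : (at_identity <= map_mx iota b)%MS.
Proof.
apply: tangent_field_point => h hI; rewrite -dquot_map; apply: (partial_vanish evI wI).
by move=> g g' hg hg'; rewrite meval_comp quot_mapE; apply/hI/ag_memM => //; apply: ag_memV.
Qed.

Variable xi : 'rV[k]_n.

(** Differentiate rhoM, written for g = (g h^-1) h, in g alone, then put g = h equal to the generic
    point; only the factor rho(g h^-1) depends on g, and it is differentiated at the identity. *)
Lemma drho_generic j : \sum_i ev (tnth (rho b xi) j)^`M(i) * w i =
  \sum_i ev (Ad_pol b i j) * \sum_a iota (tnth (rho b xi) i)^`M(a).@[e 0] * at_identity 0 a.
Proof.
pose E := (tnth (rho b xi) j \mPo left_vars) -
  \sum_i (Ad_pol b i j \mPo right_vars) * (tnth (rho b xi) i \mPo quot_map).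
have := partial_vanish evI wI (E := E).
have dE i : ev (E^`M(lshift m i) \mPo diag) = ev (tnth (rho b xi) j)^`M(i) -
    \sum_i0 ev (Ad_pol b i0 j) * ev ((tnth (rho b xi) i0 \mPo quot_map)^`M(lshift m i) \mPo diag).
  rewrite mderivB comp_mpolyB rmorphB; congr (_ - _).
    rewrite mderiv_comp (bigD1 i) //= big1 ?addr0 => [|z zi].
      rewrite tnth_left_vars mderivXU eqxx mulr1.
      apply: ev_eq => x hx; rewrite !meval_comp pm_eval_pair pm_eval_id left_varsE //.
    rewrite tnth_left_vars mderivXU (_ : _ == _ = false) ?mulr0 //.
    by apply/negbTE; apply: contraNneq zi => /lshift_inj ->.
  rewrite (raddf_sum (mderiv _)) (raddf_sum (comp_mpoly diag)) (raddf_sum ev) /=.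
  apply: eq_bigr => i0 _.
  have z0 : (Ad_pol b i0 j \mPo right_vars)^`M(lshift m i) = 0.
    by rewrite mderiv_comp big1 // => z _; rewrite tnth_right_vars mderivXU eq_rlshift mulr0.
  rewrite mderivM z0 mul0r add0r (rmorphM (comp_mpoly diag)) rmorphM; congr (_ * _).
  by apply: ev_eq => x hx; rewrite !meval_comp pm_eval_pair pm_eval_id right_varsE.
under eq_bigr => i _ do rewrite dE mulrBl.
rewrite sumrB => h; apply/eqP; rewrite -subr_eq0.
under [X in _ - X == _]eq_bigr => i _ do rewrite -dquot_map mulr_sumr.
rewrite exchange_big /=.
under [X in _ - X == _]eq_bigr => i _ do (under eq_bigr => z _ do rewrite mulrA; rewrite -mulr_suml).
apply/eqP/h => g g' hg hg'.
rewrite mevalB meval_comp left_varsE (raddf_sum (meval _)) /=.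
rewrite -pm_evalE -{1}(ag_mulgK hg hg') rhoM //; last by apply: ag_memM => //; apply: ag_memV.
apply/eqP; rewrite subr_eq0; apply/eqP; apply: eq_bigr => i _.
by rewrite mevalM !meval_comp right_varsE quot_mapE pm_evalE.
Qed.

Lemma drho_generic_mx : exists la : 'rV[L]_n, forall j,
  \sum_i ev (tnth (rho b xi) j)^`M(i) * w i =
  - (la *m (map_mx iota (Lie_mx b xi))^T *m (\matrix_(i, j) ev (Ad_pol b i j))) 0 j.
Proof.
have /submxP[la E] := at_identity_tangent; exists la => j.
rewrite drho_generic mxE -sumrN; apply: eq_bigr => i _.
rewrite [X in _ = - (_ * X)]mxE mulrC -mulNr; congr (_ * _).
rewrite E; under eq_bigr => a _ do rewrite mxE mulr_sumr.
rewrite exchange_big mxE -sumrN; apply: eq_bigr => s _ /=.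
rewrite [_^T s i]mxE [map_mx _ (Lie_mx _ _) _ _]mxE -mulrN.
have -> : - ev (Lie_mx b xi i s)%:MP = iota (dpoly (tnth (rho b xi) i) e (delta_mx 0 s *m b)).
  have -> : Lie_mx b xi i s = coad b (delta_mx 0 s) xi 0 i by rewrite mxE.
  rewrite -pm_diffE drho //; move: (coad b _ xi) => c.
  by rewrite [(- c) 0 i]mxE /= mpolyCN rmorphN.
rewrite /dpoly rmorph_sum mulr_sumr; apply: eq_bigr => a _.
by rewrite -rowE !mxE rmorphM /=; ring.
Qed.

End AtGenericPoint.

(** Pull the d independent functions back to G and take derivations dual to them at a generic point.
    Moved to the identity, their effect on the orbit map factors through [Lie_mx b xi], so an
    identity matrix of size d does too. *)
Lemma orbit_dim_le xi d : dim_ge (orbit_of b xi) d -> (d <= \rank (Lie_mx b xi))%N.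
Proof.
move=> [f hf]; pose F : d.-tuple {mpoly k[m]} := pm_comp f (rho b xi).
have Iid : is_ideal (vanishes_on mem).
  split=> [x _|p q hp hq x hx|p q hq x hx]; first by rewrite meval0.
    by rewrite mevalD hp // hq // addr0.
  by rewrite mevalM hq // mulr0.
have [|L [ev [evI evF]]] := @generic_point k m d (vanishes_on mem) F Iid.
  move=> P hP; apply: hf => eta /orbit_rho[g hg ->].
  rewrite -meval_comp -(hP g hg); congr (_.@[_]).
  move: P {hP}; apply: (@mpoly_rmorph_ext _ _ _ (comp_mpoly (rho b xi) \o comp_mpoly f)
    (comp_mpoly F)) => [c|i] /=; first by rewrite !comp_mpolyC.
  by rewrite !comp_mpolyXU -!tnth_nth tnth_mktuple.
have [W hW] := derivation_lift evF char0.
have /boolp.choice[la hla] q : exists la : 'rV[L]_n, forall j,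
    \sum_i ev (tnth (rho b xi) j)^`M(i) * W q i = - (la *m
      (map_mx (ev \o @mpolyC m k) (Lie_mx b xi))^T *m (\matrix_(i, j) ev (Ad_pol b i j))) 0 j.
  apply: drho_generic_mx => // h hI; exact: ((hW q).1 h (evI h hI)).
pose La : 'M[L]_(d, n) := \matrix_(q, i) - la q 0 i.
pose Ad := \matrix_(i, j) ev (Ad_pol b i j).
pose K : 'M[L]_(n, d) := \matrix_(j, i) ev ((tnth f i)^`M(j) \mPo rho b xi).
pose Li := (map_mx (ev \o @mpolyC m k) (Lie_mx b xi))^T.
have E1 : La *m Li *m Ad *m K = 1%:M.
  apply/matrixP => q i; rewrite [RHS]mxE eq_sym -(hW q).2 mxE.
  rewrite tnth_mktuple; under [RHS]eq_bigr => j _ do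
    rewrite mderiv_comp (raddf_sum ev) /= mulr_suml.
  rewrite exchange_big; apply: eq_bigr => j _ /=.
  under [RHS]eq_bigr => z _ do rewrite rmorphM /= -mulrA.
  rewrite -mulr_sumr hla mulrC [K j i]mxE; congr (_ * _).
  have -> : (La *m Li *m Ad) q j = (row q (La *m Li *m Ad)) 0 j by rewrite [RHS]mxE.
  rewrite !row_mul (_ : row q La = - la q); last by apply/rowP => z; rewrite !mxE.
  by rewrite !mulNmx [LHS]mxE.
rewrite -(@mxrank1 L d) -E1 -mulmxA (leq_trans (mxrankM_maxl _ _)) //.
by rewrite (leq_trans (mxrankM_maxr _ _)) // mxrank_tr mxrank_map.
Qed.

End OrbitUpper.

(** * The theorem *)

Section LinearAlgebra.
Variable k : fieldType.

Lemma complement_rows n l (N : 'M[k]_n) : (\rank N + l = n)%N ->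
  exists T : 'M[k]_(l, n), row_full (N + T)%MS /\
    forall (y : 'rV_l) (z : 'rV_n), y *m T + z *m N = 0 -> y = 0 /\ z *m N = 0.
Proof.
move=> rl; have e : \rank (N^C)%MS = l.
  by rewrite mxrank_compl; move: rl; move: (\rank N) => a; lia.
case: l / e rl => _; exists (row_base (N^C)%MS); split.
  by rewrite (eq_row_full (adds_eqmx (eqmx_refl N) (eq_row_base _))) addsmx_compl_full.
move=> y z yz; have yT : y *m row_base (N^C)%MS = 0.
  apply/eqP; rewrite -submx0 -(capmx_compl N) sub_capmx.
  rewrite {1}(_ : y *m _ = - z *m N); last by apply/eqP; rewrite mulNmx -addr_eq0 yz.
  by rewrite submxMl -(eq_row_base (N^C)%MS) submxMl.
split; last by move: yz; rewrite yT add0r.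
by apply: (row_free_inj (row_base_free (N^C)%MS)); rewrite yT mul0mx.
Qed.

(** Border N by complements of its row space and of the row space of its transpose. In a left kernel
    vector the complement of the row space kills the last l entries; the rest is then killed by a
    spanning set. *)
Lemma bordered_full n l (N : 'M[k]_n) : (\rank N + l = n)%N ->
  exists A B : 'M[k]_(n, l), \det (bordered N A B) != 0.
Proof.
move=> rl; have [T [_ hT]] := complement_rows rl.
have [|T' [fT' _]] := @complement_rows n l N^T; first by rewrite mxrank_tr.
exists T'^T, T^T; rewrite -unitfE -unitmxE -row_free_unit -kermx_eq0.
apply/eqP/row_matrixP => i; rewrite row0; set u := row i _.
have : u *m bordered N T'^T T^T = 0.
  by apply/sub_kermxP; rewrite /u row_sub.
rewrite -[u]hsubmxK /bordered mul_row_block trmxK mulmx0 addr0 -[0 in RHS]row_mx0.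
move=> /eq_row_mx[]; rewrite addrC => /hT[-> xN] xT'.
suff -> : lsubmx u = 0 by rewrite row_mx0.
apply: trmx_inj; rewrite trmx0.
have /row_fullP[Q QT] := fT'.
rewrite -[(lsubmx u)^T]mul1mx -QT -mulmxA.
suff -> : (N^T + T')%MS *m (lsubmx u)^T = 0 by rewrite mulmx0.
have /submxP[E ->] : ((N^T + T')%MS <= col_mx N^T T')%MS by rewrite addsmxE.
rewrite -mulmxA mul_col_mx -trmx_mul xN trmx0.
have -> : T' *m (lsubmx u)^T = 0.
  by apply: trmx_inj; rewrite trmx_mul trmxK xT' trmx0.
by rewrite col_mx0 mulmx0.
Qed.

(** Bordering by l columns and l rows raises the rank by at most 2l, and the result has rank n +
    l. *)
Lemma bordered_rank n l (N : 'M[k]_n) (A B : 'M[k]_(n, l)) :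
  \det (bordered N A B) != 0 -> (n <= \rank N + l)%N.
Proof.
rewrite -unitfE -unitmxE => /mxrank_unit; rewrite /bordered block_mxEv => e.
have := mxrank_adds_leqif (row_mx N A) (row_mx B^T 0) => -[].
rewrite addsmxE e => le1 _.
have le2 : (\rank (row_mx N A) <= \rank N + l)%N.
  have -> : row_mx N A = N *m row_mx 1%:M 0 + A *m row_mx 0 1%:M.
    by rewrite !mul_mx_row !mulmx1 !mulmx0 add_row_mx addr0 add0r.
  apply: leq_trans (mxrank_add _ _) _; apply: leq_add; first exact: mxrankM_maxl.
  by apply: leq_trans (mxrankM_maxr _ _) _; rewrite rank_leq_row.
have := rank_leq_row (row_mx B^T (0 : 'M_l)).
by move: le1 le2; move: (\rank _) (\rank _) (\rank _) => a c d; lia.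
Qed.

End LinearAlgebra.

Section Dimension.
Variables (k : fieldType) (char0 : [pchar k] =i pred0) (n : nat).

Lemma dim_ge_sub (Z1 Z2 : 'rV[k]_n -> Prop) d : (forall x, Z1 x -> Z2 x) ->
  dim_ge Z1 d -> dim_ge Z2 d.
Proof. by move=> s12 [f hf]; exists f => P hP; apply: hf => x /s12; apply: hP. Qed.

Lemma dim_ge_le (Z : 'rV[k]_n -> Prop) d : dim_ge Z d -> (d <= n)%N.
Proof.
move=> [f hf]; apply: (alg_indep_le char0 (f := f)) => P P0; apply: hf => x _.
by rewrite P0 meval0.
Qed.

(** [codim_ge] speaks of the exact dimension, so pass to the largest d' with [dim_ge], which exists
    because d' is at most n. *)
Lemma codim_ge_dim (Z : 'rV[k]_n -> Prop) c d : codim_ge Z c -> dim_ge Z d -> (d + c <= n)%N.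
Proof.
move=> cZ dZ.
have [|t [[d' [dd' dZ' td']] tmin]] := @nat_least
    (fun t => exists d', [/\ (d <= d')%N, dim_ge Z d' & t = (n - d')%N]).
  by exists (n - d)%N, d.
have : has_dim Z d'.
  split=> // dZ1; have d'n := dim_ge_le dZ1.
  have : (t <= n - d'.+1)%N by apply: tmin; exists d'.+1; rewrite leqW.
  by rewrite td'; lia.
by move=> /cZ; apply: leq_trans; rewrite leq_add2r.
Qed.

End Dimension.

Section Main.
Variables (k : closedFieldType) (char0 : [pchar k] =i pred0).
Variables (G : affAlgGroup k) (n : nat) (b : 'M[k]_(n, ag_amb G)).
Hypothesis hb : lie_basis b.

Lemma regular_rank l xi : is_index b l -> regular b xi -> (\rank (Lie_mx b xi) + l = n)%N.
Proof.
move=> [[xi0 sl] lmin] [d [dO dO1] dmax].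
have r0 := Lie_mx_rank b xi0; rewrite sl in r0.
have : has_dim (orbit_of b xi0) (\rank (Lie_mx b xi0)).
  by split; [exact: orbit_dim_ge|move=> /(orbit_dim_le char0 hb); rewrite ltnn].
move=> /dmax d0; have d1 := orbit_dim_le char0 hb dO.
have := lmin xi; have := Lie_mx_rank b xi; move: r0 d0 d1.
by move: (\rank _) (\rank _) (stab_dim _ _) => a c s; lia.
Qed.

Lemma invariantC c : invariant b c%:MP.
Proof. by move=> g xi _; rewrite !mevalC. Qed.

Lemma invariantD p q : invariant b p -> invariant b q -> invariant b (p + q).
Proof. by move=> hp hq g xi hg; rewrite !mevalD hp ?hq. Qed.

Lemma invariantM p q : invariant b p -> invariant b q -> invariant b (p * q).
Proof. by move=> hp hq g xi hg; rewrite !mevalM hp ?hq. Qed.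

Definition Lie_poly : 'M[{mpoly k[n]}]_n :=
  \matrix_(i, j) - \sum_c br b (delta_mx 0 j) (delta_mx 0 i) 0 c *: 'X_c.

Lemma Lie_polyE (x : 'I_n -> k) i j :
  (Lie_poly i j).@[x] = - \sum_c br b (delta_mx 0 j) (delta_mx 0 i) 0 c * x c.
Proof.
rewrite mxE mevalN (raddf_sum (meval _)); congr (- _); apply: eq_bigr => c _ /=.
by rewrite mevalZ mevalXU.
Qed.

Lemma Lie_poly_eval (xi : 'rV[k]_n) : map_mx (meval (xi 0)) Lie_poly = Lie_mx b xi.
Proof.
apply/matrixP => i j; rewrite [LHS]mxE Lie_polyE [RHS]mxE coadE; congr (- _).
by apply: eq_bigr => c _; rewrite mulrC.
Qed.

Lemma Lie_poly_skew : Lie_poly^T = - Lie_poly.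
Proof.
apply/matrixP => i j; rewrite [LHS]mxE [RHS]mxE [in LHS]mxE [X in _ = - X]mxE.
congr (- _); rewrite -sumrN; apply: eq_bigr => c _; rewrite br_antisym.
by rewrite [(- br _ _ _) 0 c]mxE scaleNr.
Qed.

Lemma Lie_poly_linear i j t (x : 'I_n -> k) :
  (Lie_poly i j).@[fun z => t * x z] = t * (Lie_poly i j).@[x].
Proof.
rewrite !Lie_polyE mulrN mulr_sumr; congr (- _); apply: eq_bigr => c _.
by rewrite mulrCA.
Qed.

Lemma mpoly_ext0 (p : {mpoly k[n]}) : (forall xi : 'rV[k]_n, p.@[xi 0] = 0) -> p = 0.
Proof.
move=> p0; apply/eqP/negPn/negP => /(meval_nonzero char0)[v /negP]; apply.
by rewrite -(meval_eq (v1 := (\row_i v i) 0)) ?p0 // => i; rewrite mxE.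
Qed.

Lemma jacobian_Lie_poly r (F : r.-tuple {mpoly k[n]}) :
  (forall i, invariant b (tnth F i)) -> jacobian F *m Lie_poly = 0.
Proof.
move=> Finv; apply/matrixP => i j; rewrite [RHS]mxE; apply: mpoly_ext0 => xi.
rewrite mxE (raddf_sum (meval _)) /=.
apply: etrans (invariant_coad hb (delta_mx 0 j) xi (Finv i)).
apply: eq_bigr => a _; rewrite mevalM [jacobian F i a]mxE; congr (_ * _).
by have /matrixP/(_ a j) := Lie_poly_eval xi; rewrite [LHS]mxE [RHS]mxE.
Qed.

Lemma bordered_meval l (A B : 'M[k]_(n, l)) (xi : 'rV[k]_n) :
  (\det (bordered Lie_poly (map_mx (@mpolyC n k) A) (map_mx (@mpolyC n k) B))).@[xi 0] =
  \det (bordered (Lie_mx b xi) A B).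
Proof.
rewrite -det_map_mx /bordered map_block_mx map_mx0 Lie_poly_eval -map_trmx.
have cstK (C : 'M[k]_(n, l)) : map_mx (meval (xi 0)) (map_mx (@mpolyC n k) C) = C.
  by apply/matrixP => i j; rewrite !mxE mevalC.
by rewrite !cstK.
Qed.

(** At a point where neither minor vanishes, the Jacobian has rank r and the coadjoint matrix rank
    at least n - l, while their product is zero. *)
Lemma invariant_rank_le l r (F : r.-tuple {mpoly k[n]}) : is_index b l ->
  (forall i, invariant b (tnth F i)) ->
  (forall P : {mpoly k[r]}, P \mPo F = 0 -> P = 0) -> (r <= l)%N.
Proof.
move=> [[xi0 sl] lmin] Finv Findep.
have r0 := Lie_mx_rank b xi0; rewrite sl in r0.
have [A [B AB]] := bordered_full r0.
have [C hC] := full_minor char0 Findep.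
set q := \det _ in hC.
pose M := \det (bordered Lie_poly (map_mx (@mpolyC n k) A) (map_mx (@mpolyC n k) B)).
have M0 : M != 0.
  by apply: contraNneq AB => M0; rewrite -bordered_meval -/M M0 meval0.
have [xi] : exists xi : 'rV[k]_n, (M * q).@[xi 0] != 0.
  apply: boolp.contrapT => no.
  have /eqP : M * q = 0.
    by apply: mpoly_ext0 => xi; apply/eqP/negPn/negP => h; apply: no; exists xi.
  by rewrite mulf_eq0 (negbTE M0) (negbTE hC).
rewrite mevalM mulf_eq0 negb_or bordered_meval => /andP[/bordered_rank Mx qx].
have JL : map_mx (meval (xi 0)) (jacobian F) *m Lie_mx b xi = 0.
  by rewrite -Lie_poly_eval -map_mxM jacobian_Lie_poly // map_mx0.
have rJ : \rank (map_mx (meval (xi 0)) (jacobian F)) = r.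
  apply/eqP; rewrite eqn_leq rank_leq_row /=.
  move: qx; rewrite /q -det_map_mx -unitfE -unitmxE map_mxM => /mxrank_unit {1}<-.
  exact: mxrankM_maxl.
have := mulmx0_rank_max JL; rewrite rJ; move: Mx.
by move: (\rank _) => a; lia.
Qed.

Lemma vector_field_tangent (hG : wonderful3 b) (X : polymap k n n) :
  (forall f, invariant b f -> forall xi, act_on X f xi = 0) ->
  exists Y : polymap k n n, forall xi, pm_eval X xi = coad b (pm_eval Y xi) xi.
Proof.
move=> hX; have [l hl [hcodim [_ hkrull] [r [F [deg [Fgen Fhomog Fdeg]]]]]] := hG.
have [Findep FA] := Fgen.
have Finv i : invariant b (tnth F i).
  by apply/FA; exists 'X_i; rewrite comp_mpolyXU -tnth_nth.
(* The Core section borders P by l columns and uses as many generators, so index and number of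
   generators must be identified. *)
have lr : l = r.
  apply/eqP; rewrite eqn_leq (invariant_rank_le hl Finv Findep) andbT.
  exact: (krull_dim_le invariantC invariantD invariantM char0 Fgen hkrull.1).
case: r / lr F deg Fgen Fhomog Fdeg Findep FA Finv => F deg Fgen Fhomog Fdeg Findep FA Finv.
pose Xc : 'cV[{mpoly k[n]}]_n := \col_i tnth X i.
have [|d dZ||Yc XY] := @koszul_exact k char0 n l Lie_poly F deg Lie_poly_skew
    Lie_poly_linear (jacobian_Lie_poly Finv) Findep Fhomog Fdeg _ _ Xc.
- have [[xi0 sl] _] := hl; have r0 := Lie_mx_rank b xi0; rewrite sl in r0.
  have [A [B AB]] := bordered_full r0; exists A, B.
  by apply: contraNneq AB => M0; rewrite -bordered_meval M0 meval0.
(* At a regular point the rank is n - l and some bordered minor is nonzero; hence common zeros of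
   the minors are not regular. *)
- apply: (codim_ge_dim char0 hcodim); apply: dim_ge_sub dZ => xi M0 /(regular_rank hl) rl.
  have [A [B /negP]] := bordered_full rl; apply; apply/eqP.
  by rewrite -bordered_meval M0.
- apply/matrixP => i j; rewrite [RHS]mxE; apply: mpoly_ext0 => xi.
  rewrite mxE (raddf_sum (meval _)) /= -[RHS](hX _ (Finv i) xi).
  apply: eq_bigr => a _; rewrite mevalM mulrC [jacobian F i a]mxE [Xc a j]mxE.
  by rewrite pm_evalE [grad _ _ 0 a]mxE.
exists [tuple Yc i 0 | i < n] => xi; rewrite Lie_mxE // -Lie_poly_eval.
apply/rowP => i; rewrite pm_evalE [RHS]mxE [RHS]mxE.
have -> : tnth X i = (Lie_poly *m Yc) i 0 by rewrite -XY mxE.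
rewrite mxE (raddf_sum (meval _)); apply: eq_bigr => a _ /=.
rewrite mevalM; congr (_ * _); first by rewrite [RHS]mxE.
by rewrite [RHS]mxE pm_evalE tnth_mktuple.
Qed.

End Main.

Theorem theorem0p1 (k : closedFieldType) (char0 : [pchar k] =i pred0)
    (G : affAlgGroup k) (Gconn : zconnected (@ag_mem k G))
    (n : nat) (b : 'M[k]_(n, ag_amb G)) (hb : lie_basis b)
    (hG : wonderful3 b)
    (X : polymap k n n)
    (hX : forall f : {mpoly k[n]}, invariant b f ->
          forall xi : 'rV[k]_n, act_on X f xi = 0) :
  exists Y : polymap k n n,
    forall xi : 'rV[k]_n, pm_eval X xi = coad b (pm_eval Y xi) xi.
Proof. exact: vector_field_tangent. Qed.
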